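(* Let $X\subseteq\mathbb{R}^N$ be finite, let $\epsilon>0$, $\delta\geq0$, $\ell>0$, and let $f:X\to\mathsf{Gr}(d,n)\subseteq\mathbb{R}^{n\times n}$ be a $\delta$-approximate $\ell$-Lipschitz map with respect to the Euclidean norm and the Frobenius norm. Then there exist a partition of unity $\phi$ subordinate to the star cover of $\check{\mathsf C}(X)(\epsilon)$ and a discrete $(2\ell\epsilon+\delta)$-approximate local trivialization $\Phi\in\mathsf{DT}_{2\ell\epsilon+\delta}(\check{\mathsf C}(X)(\epsilon);d)$ such that $\mathsf{av}^\phi(\Phi)=\check{\mathsf C}(f)(\epsilon)$. Moreover, there is a discrete $3(2\ell\epsilon+\delta)$-approximate cocycle $\Omega=\mathsf w(\Phi)$ such that $\mathsf{cl}(\Omega)$ is equal to the class of $\check{\mathsf C}(f)(\epsilon)$ in $[\check{\mathsf C}(X)(\epsilon),\mathsf{Gr}(d)^{3\sqrt2(2\ell\epsilon+\delta)}]$.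
   Context: $\|\cdot\|$ is the Frobenius norm; $[X,Y]$ denotes homotopy classes of continuous maps. $\mathsf{Gr}(d,n)=\{A\in\mathbb{R}^{n\times n}:A=A^t=A^2,\ \mathrm{rank}\,A=d\}$; $\mathsf V(d,n)$ is the set of $n\times d$ matrices with orthonormal columns; $\mathsf{Gr}(d)$, $\mathsf V(d)$, $\mathbb{R}^{\infty\times\infty}$ are the unions over $n$ of $\mathsf{Gr}(d,n)$, $\mathsf V(d,n)$, $\mathbb{R}^{n\times n}$ (padding by zeros), with the direct limit topology. For $r>0$, $\mathsf{Gr}(d,n)^r\subseteq\mathbb{R}^{n\times n}$ and $\mathsf{Gr}(d)^r\subseteq\mathbb{R}^{\infty\times\infty}$ are the sets of matrices at Frobenius distance $<r$ from $\mathsf{Gr}(d,n)$, respectively $\mathsf{Gr}(d)$; $\mathsf{Gr}(d,n)^r\subseteq\mathsf{Gr}(d)^r$. A function $f:X\to Y$ between metric spaces is $\delta$-approximate $\ell$-Lipschitz if $d_Y(f(x),f(x'))\leq\ell d_X(x,x')+\delta$ for all $x,x'$. The Čech complex $\check{\mathsf C}(X)(\epsilon)$ is the nerve of the cover $\{B(x,\epsilon)\}_{x\in X}$ by open balls in $\mathbb{R}^N$ (the same notation is used for its geometric realization); its points are formal convex combinations $\sum_xc_x[x]$ with $\bigcap_{x:c_x>0}B(x,\epsilon)\ne\emptyset$. The map $\check{\mathsf C}(f)(\epsilon):\check{\mathsf C}(X)(\epsilon)\to\mathsf{Gr}(d,n)^{2\ell\epsilon+\delta}$ is $\sum_xc_x[x]\mapsto\sum_xc_xf(x)$.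 Let $K$ be a simplicial complex. The star cover of $|K|$ consists of the open stars $\mathrm{st}(i)$ of the vertices $i$; its nerve is $K$. A discrete $r$-approximate local trivialization $\Phi\in\mathsf{DT}_r(K;d)$ is a family $\{\Phi_i\in\mathsf V(d)\}_{i}$ indexed by the vertices such that for every ordered 1-simplex $(ij)$ there is $\Omega_{ij}\in O(d)$ with $\|\Phi_i\Omega_{ij}-\Phi_j\|<r$; such a family $\Omega$ is called a witness. For a partition of unity $\phi$ subordinate to the star cover, $\mathsf{av}^\phi(\Phi):|K|\to\mathbb{R}^{\infty\times\infty}$ is $y\mapsto\sum_i\phi_i(y)\Phi_i\Phi_i^t$. $\mathsf w(\Phi)$ denotes a choice of witness $\Omega$ for $\Phi$ which is symmetric ($\Omega_{ij}=\Omega_{ji}^t$, $\Omega_{ii}=\mathrm{id}$). A discrete $r$-approximate cocycle on $K$ is a symmetric family $\{\Omega_{ij}\in O(d)\}$ indexed by ordered 1-simplices with $\|\Omega_{ij}\Omega_{jk}-\Omega_{ik}\|<r$ for all ordered 2-simplices $(ijk)$. Construction of $\mathsf{cl}$ for a discrete $r$-approximate cocycle $\Omega$ on a finite complex $K$: choose a partition of unity $\psi$ subordinate to the star cover and an injection $\iota$ from the vertices to $\{1,2,\dots\}$; let $\Xi_i:\mathrm{st}(i)\to\mathsf V(d)$ have, for each vertex $j$, rows from $d\,\iota(j)$ to $d(\iota(j)+1)-1$ equal to $\sqrt{\psi_j(y)}\,\Omega_{ij}^t$ (zero if $y\notin\mathrm{st}(j)$), other rows zero. Then $\mathsf{cl}(\Omega)\in[|K|,\mathsf{Gr}(d)^{\sqrt2r}]$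 is the homotopy class of $y\mapsto\sum_i\psi_i(y)\Xi_i(y)\Xi_i(y)^t$; it does not depend on choices. *)

(* Defs.v *)
From HB Require Import structures.
From mathcomp Require Import all_boot all_order all_algebra finmap.
From mathcomp Require Import all_classical all_reals all_analysis.

Set Implicit Arguments.
Unset Strict Implicit.
Unset Printing Implicit Defensive.

Import Order.TTheory GRing.Theory Num.Theory.
Import numFieldNormedType.Exports.

Local Open Scope classical_set_scope.
Local Open Scope ring_scope.

Section FiniteMatrices.
Variable R : realType.

(* The library norm on matrices is the maximum norm; on row vectors [frob] is
   the Euclidean norm. *)
Definition frob (m n : nat) (A : 'M[R]_(m, n)) : R :=
  Num.sqrt (\sum_i \sum_j A i j ^+ 2).

Definition frob_dist (m n : nat) (A B : 'M[R]_(m, n)) : R := frob (A - B).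

Definition orthogonal_group (d : nat) : set 'M[R]_d :=
  [set W | W^T *m W = 1%:M].

Definition Gr (d n : nat) : set 'M[R]_n :=
  [set A | [/\ A^T = A, A *m A = A & \rank A = d]].

Definition Stiefel (d n : nat) : set 'M[R]_(n, d) :=
  [set A | A^T *m A = 1%:M].

Definition approx_lipschitz (X Y : Type) (dX : X -> X -> R) (dY : Y -> Y -> R)
    (delta ell : R) (f : X -> Y) : Prop :=
  forall x x', dY (f x) (f x') <= ell * dX x x' + delta.

End FiniteMatrices.

Arguments orthogonal_group R d : clear implicits.
Arguments Gr R d n : clear implicits.
Arguments Stiefel R d n : clear implicits.

(* The union of the R^(n x n) is the type [fsmx R nat nat] of the finitely
   supported nat x nat matrices; infinite frames are in [fsmx R nat 'I_d]. *)

Section FinSuppMatrices.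
Variables (R : realType) (I J : choiceType).

Definition fs_supp (A : I -> J -> R) : set (I * J) :=
  [set p | A p.1 p.2 != 0].

Definition fs_pred : {pred I -> J -> R^o} :=
  [pred A | `[< finite_set (fs_supp A) >]].

Fact fs_submod_closed : submod_closed fs_pred.
Proof.
split.
  apply/asboolP/(sub_finite_set _ (finite_set0 _)) => p.
  by rewrite /fs_supp /= eqxx.
move=> a A B /asboolP fA /asboolP fB; apply/asboolP.
have : finite_set (fs_supp A `|` fs_supp B) by rewrite finite_setU.
apply: sub_finite_set => p; rewrite /fs_supp /=.
case: (eqVneq (A p.1 p.2) 0) => [A0|]; last by left.
case: (eqVneq (B p.1 p.2) 0) => [B0|]; last by right.
by rewrite !fctE A0 B0 addr0 scaler0 eqxx.
Qed.

HB.instance Definition _ :=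
  GRing.isSubmodClosed.Build R (I -> J -> R^o) fs_pred fs_submod_closed.

Record fsmx := FSMx {
  fsmx_fun :> I -> J -> R^o;
  fsmx_funP : fsmx_fun \in fs_pred }.

HB.instance Definition _ := [isSub for fsmx_fun].
HB.instance Definition _ := [Choice of fsmx by <:].
HB.instance Definition _ := [SubChoice_isSubLmodule of fsmx by <:].

Definition fs_frob (A : fsmx) : R :=
  Num.sqrt (\sum_(p \in [set: I * J]) A p.1 p.2 ^+ 2).

End FinSuppMatrices.

Section InfiniteMatrices.
Variable R : realType.

Definition padding_fun (n : nat) (M : 'M[R]_n) : nat -> nat -> R^o :=
  fun k l => \sum_(i < n | i == k :> nat) \sum_(j < n | j == l :> nat) M i j.

Fact padding_funP (n : nat) (M : 'M[R]_n) : padding_fun M \in @fs_pred R nat nat.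
Proof.
apply/asboolP; apply: (@sub_finite_set _ _ (`I_n `*` `I_n)); last first.
  exact: finite_setX.
move=> [k l]; rewrite /fs_supp /padding_fun /=; apply: contra_neqP => /not_andP.
case=> [kn|ln].
  by rewrite big1// => i /eqP ik; case: kn; rewrite -ik.
by rewrite big1// => i _; rewrite big1// => j /eqP jl; case: ln; rewrite -jl.
Qed.

Definition padding (n : nat) (M : 'M[R]_n) : fsmx R nat nat :=
  FSMx (padding_funP M).

(* Rows s, ..., s + n - 1 are those of M, the others are zero. *)
Definition rows_from_fun (n d s : nat) (M : 'M[R]_(n, d)) : nat -> 'I_d -> R^o :=
  fun k a => \sum_(b < n | (s + b == k)%N) M b a.

Fact rows_from_funP (n d s : nat) (M : 'M[R]_(n, d)) :
  rows_from_fun s M \in @fs_pred R nat 'I_d.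
Proof.
apply/asboolP; apply: (@sub_finite_set _ _ (`I_(s + n) `*` [set: 'I_d])); last first.
  exact: finite_setX.
move=> [k a]; rewrite /fs_supp /rows_from_fun /=; apply: contra_neqP => kn.
rewrite big1// => b /eqP bk; case: kn; split=> //.
by rewrite -bk ltn_add2l.
Qed.

Definition rows_from (n d s : nat) (M : 'M[R]_(n, d)) : fsmx R nat 'I_d :=
  FSMx (rows_from_funP s M).

Definition fs_mulmx_fun (d : nat) (A : fsmx R nat 'I_d) (W : 'M[R]_d) :
  nat -> 'I_d -> R^o := fun k a => \sum_(b < d) A k b * W b a.

Fact fs_mulmx_funP (d : nat) (A : fsmx R nat 'I_d) (W : 'M[R]_d) :
  fs_mulmx_fun A W \in @fs_pred R nat 'I_d.
Proof.
have /asboolP fA := fsmx_funP A; apply/asboolP.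
apply: (@sub_finite_set _ _ ((fst @` fs_supp A) `*` [set: 'I_d])); last first.
  by apply: finite_setX => //; exact: finite_image.
move=> [k a]; rewrite {1}/fs_supp /fs_mulmx_fun /=; apply: contra_neqP => kn.
rewrite big1// => b _; have [->|Akb] := eqVneq (A k b) 0; first by rewrite mul0r.
by case: kn; split=> //; exists (k, b).
Qed.

Definition fs_mulmx (d : nat) (A : fsmx R nat 'I_d) (W : 'M[R]_d) :
  fsmx R nat 'I_d := FSMx (fs_mulmx_funP A W).

Definition gram_fun (d : nat) (A : fsmx R nat 'I_d) : nat -> nat -> R^o :=
  fun k l => \sum_(a < d) A k a * A l a.

Fact gram_funP (d : nat) (A : fsmx R nat 'I_d) : gram_fun A \in @fs_pred R nat nat.
Proof.
have /asboolP fA := fsmx_funP A; apply/asboolP.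
apply: (@sub_finite_set _ _ ((fst @` fs_supp A) `*` (fst @` fs_supp A))); last first.
  by apply: finite_setX => //; exact: finite_image.
move=> [k l]; rewrite {1}/fs_supp /gram_fun /=; apply: contra_neqP => kn.
rewrite big1// => b _; have [->|Akb] := eqVneq (A k b) 0; first by rewrite mul0r.
have [->|Alb] := eqVneq (A l b) 0; first by rewrite mulr0.
by case: kn; split; [exists (k, b)|exists (l, b)].
Qed.

(* A A^T, not A^T A. *)
Definition gram (d : nat) (A : fsmx R nat 'I_d) : fsmx R nat nat :=
  FSMx (gram_funP A).

(* Direct limit topology on R^(oo x oo): the final topology for the inclusions
   of the R^(n x n). *)
Definition colim_open : set_system (fsmx R nat nat) :=
  [set U | forall n, open ((@padding n) @^-1` U)].

Fact colim_openT : colim_open [set: fsmx R nat nat].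
Proof. by move=> n; rewrite preimage_setT; exact: openT. Qed.

Fact colim_openI : setI_closed colim_open.
Proof. by move=> U W oU oW n; rewrite preimage_setI; exact: openI. Qed.

Fact colim_open_bigU (I : Type) (F : I -> set (fsmx R nat nat)) :
  (forall i, colim_open (F i)) -> colim_open (\bigcup_i F i).
Proof.
by move=> oF n; rewrite preimage_bigcup; apply: bigcup_open => i _; exact: oF.
Qed.

HB.instance Definition _ := isOpenTopological.Build (fsmx R nat nat)
  colim_openT colim_openI colim_open_bigU.

Definition Gr_oo (d : nat) : set (fsmx R nat nat) :=
  \bigcup_n (@padding n @` Gr R d n).

Definition Stiefel_oo (d : nat) : set (fsmx R nat 'I_d) :=
  \bigcup_n (@rows_from n d 0 @` Stiefel R d n).

Definition Gr_oo_nbhd (d : nat) (r : R) : set (fsmx R nat nat) :=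
  [set A | exists2 P, Gr_oo d P & fs_frob (A - P) < r].

End InfiniteMatrices.

(* The maps from T to the subspace B of U are the maps from T to U with values
   in B, and [hclass] is the class of a map in [T, B]. *)

Section Homotopy.
Variables (R : realType) (T U : topologicalType) (B : set U).

Definition homotopic (f g : T -> U) : Prop :=
  exists H : T * R -> U,
    [/\ {within [set: T] `*` `[0, 1]%classic, continuous H},
        (forall t s, s \in `[0, 1] -> B (H (t, s))),
        (forall t, H (t, 0) = f t) &
        (forall t, H (t, 1) = g t)].

Definition is_map (f : T -> U) : Prop := continuous f /\ forall t, B (f t).

Definition hclass (f : T -> U) : set (T -> U) :=
  [set g | is_map g /\ homotopic f g].

End Homotopy.

Definition partition_of_unity (R : realType) (V : finType) (T : topologicalType)
    (phi : V -> T -> R) : Prop :=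
  [/\ forall i, continuous (phi i),
      forall i t, 0 <= phi i t &
      forall t, \sum_i phi i t = 1].

(* Subordination is meant for the sets where phi_i does not vanish, not for
   their closures: the barycentric coordinates are subordinate to the cover by
   open stars. *)
Definition subordinate (R : realType) (V : finType) (T : topologicalType)
    (phi : V -> T -> R) (U : V -> set T) : Prop :=
  forall i t, phi i t != 0 -> U i t.

Record scomplex (V : finType) := SComplex {
  face : {set V} -> Prop;
  face_neq0 : forall s, face s -> s != finset.set0;
  face_vertex : forall v, face [set v]%SET;
  face_sub : forall s t : {set V},
    face s -> t \subset s -> t != finset.set0 -> face t }.

Section Nerve.
Variables (V : finType) (T : Type) (U : V -> set T).
Hypothesis U_neq0 : forall v, U v !=set0.

Definition nerve_face (s : {set V}) : Prop :=
  s != finset.set0 /\ \bigcap_(v in [set` s]) U v !=set0.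

Fact nerve_face_neq0 s : nerve_face s -> s != finset.set0.
Proof. by case. Qed.

Fact nerve_face_vertex v : nerve_face [set v]%SET.
Proof.
split; first by apply/set0Pn; exists v; rewrite set11.
by have [p Uvp] := U_neq0 v; exists p => w /=; rewrite finset.in_set1 => /eqP ->.
Qed.

Fact nerve_face_sub (s t : {set V}) :
  nerve_face s -> t \subset s -> t != finset.set0 -> nerve_face t.
Proof.
move=> [_ [p Up]] /fintype.subsetP ts t0; split=> //; exists p => v /= vt.
by apply: Up; exact: ts.
Qed.

Definition nerve : scomplex V :=
  SComplex nerve_face_neq0 nerve_face_vertex nerve_face_sub.

End Nerve.

Section Cech.
Variables (R : realType) (N : nat).

Definition eball (c : 'rV[R]_N) (eps : R) : set 'rV[R]_N :=
  [set p | frob_dist c p < eps].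

Fact eball_neq0 (X : {fset 'rV[R]_N}) (eps : R) : 0 < eps ->
  forall x : X, eball (val x) eps !=set0.
Proof.
move=> e0 x; exists (val x); rewrite /eball /frob_dist /frob /= subrr.
rewrite big1 ?sqrtr0// => i _; rewrite big1// => j _.
by rewrite !mxE expr0n.
Qed.

Definition cech (X : {fset 'rV[R]_N}) (eps : R) (eps_gt0 : 0 < eps) : scomplex X :=
  nerve (eball_neq0 (X := X) eps_gt0).

End Cech.

Section Realization.
Variables (R : realType) (V : finType) (K : scomplex V).

(* The geometric realization |K|, as a subspace of R^V: a point is the family
   of its barycentric coordinates.  As V is finite, this is the weak topology. *)
Definition geom : set {ptws V -> R} :=
  [set c | [/\ forall v, 0 <= c v,
               \sum_v c v = 1 &
               face K [set v | c v != 0]%SET]].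

Definition open_star (i : V) : set geom := [set y | 0 < set_val y i].

End Realization.

Arguments geom R {V} K.
Arguments open_star R {V} K i.

Definition cech_map (R : realType) (N n : nat) (X : {fset 'rV[R]_N}) (eps : R)
    (eps_gt0 : 0 < eps) (f : X -> 'M[R]_n) (y : geom R (cech X eps_gt0)) :
    'M[R]_n :=
  \sum_(x : X) set_val y x *: f x.

Arguments cech_map {R N n X eps} eps_gt0 f y.

(* A family indexed by the ordered 1-simplices is a function on V * V which is
   only constrained on these.  Ordered simplices may be degenerate: (ii) is one,
   as symmetric families are required to be the identity there. *)

Section Discrete.
Variables (R : realType) (d : nat) (V : finType) (K : scomplex V).

Definition edge (i j : V) : Prop := face K [set i; j]%SET.

Definition triangle (i j k : V) : Prop := face K [set i; j; k]%SET.

Definition witness (r : R) (Phi : V -> fsmx R nat 'I_d)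
    (Om : V -> V -> 'M[R]_d) : Prop :=
  forall i j, edge i j ->
    orthogonal_group R d (Om i j) /\
    fs_frob (fs_mulmx (Phi i) (Om i j) - Phi j) < r.

Definition DT (r : R) : set (V -> fsmx R nat 'I_d) :=
  [set Phi | (forall i, Stiefel_oo (Phi i)) /\
    forall i j, edge i j -> exists2 W, orthogonal_group R d W &
      fs_frob (fs_mulmx (Phi i) W - Phi j) < r].

Definition sym_family (Om : V -> V -> 'M[R]_d) : Prop :=
  (forall i j, edge i j -> Om i j = (Om j i)^T) /\ forall i, Om i i = 1%:M.

Definition approx_cocycle (r : R) (Om : V -> V -> 'M[R]_d) : Prop :=
  [/\ forall i j, edge i j -> orthogonal_group R d (Om i j),
      sym_family Om &
      forall i j k, triangle i j k -> frob (Om i j *m Om j k - Om i k) < r].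

Definition av (phi : V -> geom R K -> R) (Phi : V -> fsmx R nat 'I_d)
    (y : geom R K) : fsmx R nat nat :=
  \sum_i phi i y *: gram (Phi i).

(* This is Xi_i(y), with rows numbered from 0; it is only meaningful for y in
   st(i).  If y is not in st(j), then psi_j(y) = 0, and otherwise (ij) is a
   1-simplex: the values of Om outside the ordered 1-simplices play no role. *)
Definition cl_frame (psi : V -> geom R K -> R) (iota : V -> nat)
    (Om : V -> V -> 'M[R]_d) (i : V) (y : geom R K) : fsmx R nat 'I_d :=
  \sum_j Num.sqrt (psi j y) *: rows_from (d * iota j) (Om i j)^T.

Definition cl_map (psi : V -> geom R K -> R) (iota : V -> nat)
    (Om : V -> V -> 'M[R]_d) (y : geom R K) : fsmx R nat nat :=
  \sum_i psi i y *: gram (cl_frame psi iota Om i y).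

Definition cl_choice (p : (V -> geom R K -> R) * (V -> nat)) : Prop :=
  [/\ partition_of_unity p.1, subordinate p.1 (open_star R K),
      injective p.2 & forall j, (0 < p.2 j)%N].

(* The class cl(Om) in [|K|, Gr(d)^(sqrt 2 r)] of an r-approximate cocycle: as
   it does not depend on the choices, it is the union over all the choices of
   the homotopy classes they give. *)
Definition cl (r : R) (Om : V -> V -> 'M[R]_d) : set (geom R K -> fsmx R nat nat) :=
  \bigcup_(p in [set p | cl_choice p])
    hclass R (Gr_oo_nbhd d (Num.sqrt 2 * r)) (cl_map p.1 p.2 Om).

End Discrete.

Arguments witness {R d V} K r Phi Om.
Arguments DT {R d V} K r.
Arguments sym_family {R d V} K Om.
Arguments approx_cocycle {R d V} K r Om.
Arguments cl {R d V} K r Om.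

(* Main.v *)
From HB Require Import structures.
Require Import Defs.
From mathcomp Require Import all_boot all_order all_algebra finmap.
From mathcomp Require Import all_classical all_reals all_analysis.
From mathcomp Require Import ring lra.

Set Implicit Arguments.
Unset Strict Implicit.
Unset Printing Implicit Defensive.

Import Order.TTheory GRing.Theory Num.Theory.
Import numFieldNormedType.Exports.

Local Open Scope classical_set_scope.
Local Open Scope ring_scope.

(* For a vertex x, let Phi_x be an orthonormal frame of the range of f(x); then
   av of (Phi_x) along the barycentric coordinates is the Cech map. On an edge,
   ||f(x) - f(x')|| < r, and an optimal rotation of one frame onto the other
   moves it by at most the distance of the projections. Triangle inequalities
   make such a symmetric witness Omega a 3r-approximate cocycle.

   The frames Phi_i and the stacked frames Xi_i(y) defining cl(Omega) both
   intertwine with Omega up to 3r. If A_i and B_i are such families of frames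
   with all A_i orthogonal to all B_j, then so are the frames
   sqrt(1-t) A_i + sqrt(t) B_i for 0 <= t <= 1, and the averages of their
   projections stay within sqrt(2) 3r of the Grassmannian: this is the homotopy.
   As the rows used by Phi and Xi overlap, Xi is first rotated into rows that
   are far away, and from there into Phi. *)

(** * The Frobenius norm *)

Section Frobenius.
Variable R : realType.

Lemma trmx_scale (m n : nat) a (A : 'M[R]_(m, n)) : (a *: A)^T = a *: A^T.
Proof. by rewrite linearZ. Qed.

Lemma mxtrace_gramE (m n : nat) (A : 'M[R]_(m, n)) :
  \tr (A^T *m A) = \sum_i \sum_j A i j ^+ 2.
Proof.
rewrite /mxtrace exchange_big /=; apply: eq_bigr => j _; rewrite mxE.
by apply: eq_bigr => i _; rewrite mxE expr2.
Qed.

Lemma mxtrace_gram_ge0 (m n : nat) (A : 'M[R]_(m, n)) : 0 <= \tr (A^T *m A).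
Proof.
rewrite mxtrace_gramE; apply: sumr_ge0 => i _; apply: sumr_ge0 => j _.
exact: sqr_ge0.
Qed.

Lemma frobE (m n : nat) (A : 'M[R]_(m, n)) : frob A = Num.sqrt (\tr (A^T *m A)).
Proof. by rewrite mxtrace_gramE. Qed.

Lemma frob_ge0 (m n : nat) (A : 'M[R]_(m, n)) : 0 <= frob A.
Proof. exact: sqrtr_ge0. Qed.

Lemma frob_sqr (m n : nat) (A : 'M[R]_(m, n)) : frob A ^+ 2 = \tr (A^T *m A).
Proof. by rewrite frobE sqr_sqrtr// mxtrace_gram_ge0. Qed.

Lemma frob_eq0 (m n : nat) (A : 'M[R]_(m, n)) : frob A = 0 -> A = 0.
Proof.
move=> /(congr1 (fun x => x ^+ 2)); rewrite frob_sqr mxtrace_gramE expr0n /=.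
move=> /psumr_eq0P A0; apply/matrixP => i j; rewrite mxE.
have /psumr_eq0P/(_ j isT)/eqP : \sum_k A i k ^+ 2 = 0.
  by apply: A0 => // k _; apply: sumr_ge0 => l _; exact: sqr_ge0.
by rewrite sqrf_eq0 => /(_ (fun k _ => sqr_ge0 _))/eqP.
Qed.

Lemma frob0 (m n : nat) : frob (0 : 'M[R]_(m, n)) = 0.
Proof. by rewrite frobE mulmx0 mxtrace0 sqrtr0. Qed.

Lemma frobZ (m n : nat) a (A : 'M[R]_(m, n)) : frob (a *: A) = `|a| * frob A.
Proof.
rewrite !frobE -scalemxAr trmx_scale -scalemxAl !mxtraceZ mulrA -expr2.
by rewrite sqrtrM ?sqr_ge0// sqrtr_sqr.
Qed.

Lemma frobN (m n : nat) (A : 'M[R]_(m, n)) : frob (- A) = frob A.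
Proof. by rewrite -scaleN1r frobZ normrN1 mul1r. Qed.

Lemma frob_distC (m n : nat) (A B : 'M[R]_(m, n)) : frob (A - B) = frob (B - A).
Proof. by rewrite -frobN opprB. Qed.

Lemma mxtrace_dotC (m n : nat) (A B : 'M[R]_(m, n)) : \tr (A^T *m B) = \tr (B^T *m A).
Proof. by rewrite -[LHS]mxtrace_tr trmx_mul trmxK. Qed.

Lemma frob_sqrD (m n : nat) (A B : 'M[R]_(m, n)) :
  frob (A + B) ^+ 2 = frob A ^+ 2 + 2 * \tr (A^T *m B) + frob B ^+ 2.
Proof.
rewrite !frob_sqr [(A + B)^T]linearD /= mulmxDl !mulmxDr !mxtraceD.
by rewrite (mxtrace_dotC B A); ring.
Qed.

Lemma frob_sqrB (m n : nat) (A B : 'M[R]_(m, n)) :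
  frob (A - B) ^+ 2 = frob A ^+ 2 - 2 * \tr (A^T *m B) + frob B ^+ 2.
Proof. by rewrite frob_sqrD frobN mulmxN linearN /= mulrN. Qed.

(** Cauchy-Schwarz: expand the squared norm of |B| A - |A| B and cancel the factor 2 |A| |B|. *)
Lemma mxtrace_dot_le (m n : nat) (A B : 'M[R]_(m, n)) :
  \tr (A^T *m B) <= frob A * frob B.
Proof.
have [/frob_eq0 -> | A0] := eqVneq (frob A) 0.
  by rewrite frob0 mul0r trmx0 mul0mx mxtrace0.
have [/frob_eq0 -> | B0] := eqVneq (frob B) 0.
  by rewrite frob0 mulr0 mulmx0 mxtrace0.
have Agt0 : 0 < frob A by rewrite lt_def A0 frob_ge0.
have Bgt0 : 0 < frob B by rewrite lt_def B0 frob_ge0.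
have := sqr_ge0 (frob (frob B *: A - frob A *: B)).
rewrite frob_sqrB !frobZ !ger0_norm ?frob_ge0//.
rewrite -scalemxAr trmx_scale -scalemxAl !mxtraceZ => h.
have {h} : 0 <= 2 * (frob A * frob B) * (frob A * frob B - \tr (A^T *m B)).
  by move: h; lra.
by rewrite pmulr_rge0 ?subr_ge0// !mulr_gt0.
Qed.

Lemma frob_triangle (m n : nat) (A B : 'M[R]_(m, n)) :
  frob (A + B) <= frob A + frob B.
Proof.
rewrite -(@ler_pXn2r _ 2)// ?nnegrE ?addr_ge0 ?frob_ge0//.
rewrite frob_sqrD; have := mxtrace_dot_le A B; lra.
Qed.

Lemma frob_sum (I : finType) (m n : nat) (F : I -> 'M[R]_(m, n)) :
  frob (\sum_i F i) <= \sum_i frob (F i).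
Proof.
elim/big_ind2 : _ => [|x1 x2 y1 y2 h1 h2|//]; first by rewrite frob0.
by apply: le_trans (frob_triangle _ _) _; exact: lerD.
Qed.

Lemma frob_mulmxl (m n p : nat) (F : 'M[R]_(m, n)) (A : 'M[R]_(n, p)) :
  F^T *m F = 1%:M -> frob (F *m A) = frob A.
Proof.
by move=> F1; rewrite !frobE trmx_mul -mulmxA (mulmxA F^T) F1 mul1mx.
Qed.

Lemma frob_mulmxr (m n p : nat) (W : 'M[R]_(n, p)) (A : 'M[R]_(m, n)) :
  W *m W^T = 1%:M -> frob (A *m W) = frob A.
Proof.
by move=> W1; rewrite !frobE trmx_mul mulmxA mxtrace_mulC mulmxA mulmxA W1 mul1mx.
Qed.

Lemma cvx_neq0 (I : finType) (c : I -> R) : \sum_i c i = 1 -> exists i, c i != 0.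
Proof.
move=> c1; have [k ck0|c00] := pickP (fun k => c k != 0); first by exists k.
have : \sum_i c i = 0 by apply: big1 => i _; apply/eqP/negPn; rewrite c00.
by rewrite c1 => /eqP; rewrite oner_eq0.
Qed.

(** Some weight is nonzero, and the strict bound there makes the whole sum strict. The bound is
    asked only at nonzero weights because only vertices of nonzero weight are known to lie in a
    common simplex. *)
Lemma cvx_sum_lt (I : finType) (c a : I -> R) (b : R) :
  (forall i, 0 <= c i) -> \sum_i c i = 1 -> (forall i, c i != 0 -> a i < b) ->
  \sum_i c i * a i < b.
Proof.
move=> c0 c1 ab; have [k ck0] := cvx_neq0 c1.
rewrite -[ltRHS]mul1r -c1 mulr_suml (bigD1 k)//= [ltRHS](bigD1 k)//=.
apply: ltr_leD; first by rewrite ltr_pM2l ?ab// lt_def ck0 c0.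
apply: ler_sum => i _; have [->|ci] := eqVneq (c i) 0; first by rewrite !mul0r.
by rewrite ler_wpM2l ?c0// ltW// ab.
Qed.

Lemma frob_cvx_lt (I : finType) (m n : nat) (c : I -> R) (F : I -> 'M[R]_(m, n))
    (P : 'M[R]_(m, n)) (b : R) :
  (forall i, 0 <= c i) -> \sum_i c i = 1 ->
  (forall i, c i != 0 -> frob (F i - P) < b) ->
  frob (\sum_i c i *: F i - P) < b.
Proof.
move=> c0 c1 Fb; rewrite -[P]scale1r -c1 scaler_suml -sumrB.
apply: le_lt_trans (frob_sum _) _.
under eq_bigr do rewrite -scalerBr frobZ ger0_norm ?c0//.
exact: cvx_sum_lt.
Qed.

(** Projections of rank d have squared norm d. The singular values of F^T G are the cosines of the
    principal angles, so both sides are twice the sum of the squared sines. *)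
Lemma frob_projB_sqr (m d : nat) (F G : 'M[R]_(m, d)) :
  F^T *m F = 1%:M -> G^T *m G = 1%:M ->
  frob (F *m F^T - G *m G^T) ^+ 2 = 2 * d%:R - 2 * frob (F^T *m G) ^+ 2.
Proof.
move=> F1 G1; rewrite frob_sqrB.
have nP (K : 'M[R]_(m, d)) : K^T *m K = 1%:M -> frob (K *m K^T) ^+ 2 = d%:R.
  by move=> K1; rewrite frob_mulmxl// frob_sqr trmxK mxtrace_mulC K1 mxtrace1.
rewrite !nP//.
have -> : \tr ((F *m F^T)^T *m (G *m G^T)) = frob (F^T *m G) ^+ 2.
  by rewrite frob_sqr !trmx_mul !trmxK mulmxA mxtrace_mulC !mulmxA.
ring.
Qed.

Lemma frob_frameB_sqr (m d : nat) (F G : 'M[R]_(m, d)) (W : 'M[R]_d) :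
  F^T *m F = 1%:M -> G^T *m G = 1%:M -> orthogonal_group R d W ->
  frob (F *m W - G) ^+ 2 = 2 * d%:R - 2 * \tr (W^T *m F^T *m G).
Proof.
move=> F1 G1 W1; rewrite frob_sqrB frob_mulmxl// !frob_sqr W1 G1 mxtrace1 trmx_mul.
ring.
Qed.

(** The squares of the two sides differ by 2 ||F^T G - W||^2, as W has squared norm d. The factor
    sqrt(2) in the radius of the neighbourhoods comes from here. *)
Lemma frob_proj_le (m d : nat) (F G : 'M[R]_(m, d)) (W : 'M[R]_d) :
  F^T *m F = 1%:M -> G^T *m G = 1%:M -> orthogonal_group R d W ->
  frob (F *m F^T - G *m G^T) <= Num.sqrt 2 * frob (F *m W - G).
Proof.
move=> F1 G1 W1.
rewrite -(@ler_pXn2r _ 2)// ?nnegrE ?mulr_ge0 ?frob_ge0 ?sqrtr_ge0//.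
rewrite exprMn [Num.sqrt 2 ^+ 2]sqr_sqrtr// frob_projB_sqr// frob_frameB_sqr//.
have := sqr_ge0 (frob (F^T *m G - W)).
rewrite frob_sqrB [frob W ^+ 2]frob_sqr W1 mxtrace1 mxtrace_dotC mulmxA; lra.
Qed.

End Frobenius.

(** * Orthonormal frames *)

Section EntrywiseContinuity.
Variables (R : realType) (T : topologicalType).

Lemma continuous_sum (I : finType) (P : pred I) (F : I -> T -> R) :
  (forall i, continuous (F i)) -> continuous (fun t => \sum_(i | P i) F i t).
Proof.
move=> cF; elim: (index_enum I) => [|i s IHs].
  by under eq_fun do rewrite big_nil; exact: cst_continuous.
under eq_fun do rewrite big_cons; case: (P i) => // t.
by apply: continuousD; [exact: cF|exact: IHs].
Qed.

(** Stated entrywise, so that sums and products of matrices reduce to real functions;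
    [mx_continuousP] returns to the matrix topology. *)
Definition mx_continuous (m n : nat) (F : T -> 'M[R]_(m, n)) : Prop :=
  forall i j, continuous (fun t => F t i j : R).

Lemma mx_continuousP (m n : nat) (F : T -> 'M[R]_(m, n)) :
  mx_continuous F -> continuous F.
Proof.
move=> cF t U [P PF sPU].
have : \forall s \near t, forall ij : 'I_m * 'I_n, P ij.1 ij.2 (F s ij.1 ij.2).
  apply: filter_forall => -[i j] /=; exact: (cF i j t _ (PF i j)).
by apply: filterS => s sP; apply: sPU => i j; exact: (sP (i, j)).
Qed.

Lemma mx_continuous_cst (m n : nat) (A : 'M[R]_(m, n)) :
  mx_continuous (fun _ => A).
Proof. by move=> i j; exact: cst_continuous. Qed.

Lemma mx_continuousM (m n p : nat) (F : T -> 'M[R]_(m, n))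
    (G : T -> 'M[R]_(n, p)) :
  mx_continuous F -> mx_continuous G -> mx_continuous (fun t => F t *m G t).
Proof.
move=> cF cG i j; under eq_fun do rewrite mxE.
apply: continuous_sum => k t; apply: continuousM; [exact: cF|exact: cG].
Qed.

Lemma mx_continuousD (m n : nat) (F G : T -> 'M[R]_(m, n)) :
  mx_continuous F -> mx_continuous G -> mx_continuous (fun t => F t + G t).
Proof.
move=> cF cG i j; under eq_fun do rewrite mxE.
by move=> t; apply: continuousD; [exact: cF|exact: cG].
Qed.

Lemma mx_continuousZ (m n : nat) (a : T -> R) (F : T -> 'M[R]_(m, n)) :
  continuous a -> mx_continuous F -> mx_continuous (fun t => a t *: F t).
Proof.
move=> ca cF i j; under eq_fun do rewrite mxE.
by move=> t; apply: continuousM; [exact: ca|exact: cF].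
Qed.

Lemma mx_continuous_sum (I : finType) (m n : nat) (F : I -> T -> 'M[R]_(m, n)) :
  (forall i, mx_continuous (F i)) -> mx_continuous (fun t => \sum_i F i t).
Proof.
move=> cF i j; under eq_fun do rewrite summxE.
by apply: continuous_sum => k; exact: cF.
Qed.

Lemma mx_continuous_tr (m n : nat) (F : T -> 'M[R]_(m, n)) :
  mx_continuous F -> mx_continuous (fun t => (F t)^T).
Proof. by move=> cF i j; under eq_fun do rewrite mxE; exact: cF. Qed.

End EntrywiseContinuity.

Section OrthonormalFrames.
Variable R : realType.

(** Gram-Schmidt, by induction on k: a nonzero column of Q = P - A A^T is fixed by P and orthogonal
    to A, so its normalisation extends A. *)
Lemma orthonormal_fixed (n d k : nat) (P : 'M[R]_n) :
  Gr R d n P -> (k <= d)%N ->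
  exists2 A : 'M[R]_(n, k), A^T *m A = 1%:M & P *m A = A.
Proof.
move=> [PT PP Pd]; elim: k => [_|k IHk kd].
  by exists 0; [rewrite [LHS]flatmx0 [RHS]flatmx0|rewrite mulmx0].
have [A A1 PA] := IHk (ltnW kd).
set Q := P - A *m A^T.
have PQ : P *m Q = Q by rewrite mulmxBr PP mulmxA PA.
have AP : A^T *m P = A^T by rewrite -[P]PT -trmx_mul PA.
have AQ : A^T *m Q = 0 by rewrite mulmxBr AP mulmxA A1 mul1mx subrr.
(* Otherwise P = A A^T would have rank at most k < d. *)
have [j Qj] : exists j, col j Q != 0.
  apply/existsP; apply: contraTT kd; rewrite negb_exists => /forallP Q0.
  have : Q = 0.
    apply/matrixP => i j; have /negPn/eqP/matrixP/(_ i ord0) := Q0 j.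
    by rewrite !mxE.
  move/eqP; rewrite subr_eq0 -leqNgt -Pd => /eqP ->.
  by rewrite (leq_trans (mxrankM_maxl _ _))// rank_leq_col.
set w := col j Q; have w0 : frob w != 0.
  by apply: contra_neq Qj; exact: frob_eq0.
have Pw : P *m w = w by rewrite /w colE mulmxA PQ.
have Aw : A^T *m w = 0 by rewrite /w colE mulmxA AQ mul0mx.
set u := (frob w)^-1 *: w.
have u1 : u^T *m u = 1%:M.
  rewrite [LHS]mx11_scalar -trace_mx11 -frob_sqr frobZ.
  by rewrite ger0_norm ?invr_ge0 ?frob_ge0// mulVf// expr1n.
have Pu : P *m u = u by rewrite -scalemxAr Pw.
have Au : A^T *m u = 0 by rewrite -scalemxAr Aw scaler0.
rewrite -addn1; exists (row_mx A u); last by rewrite mul_mx_row PA Pu.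
rewrite tr_row_mx mul_col_row A1 u1 Au -[u^T *m A]trmxK trmx_mul trmxK Au trmx0.
by rewrite -scalar_mx_block.
Qed.

(** For d orthonormal vectors fixed by P, A^T and P have the same row space by counting ranks. Hence
    P = X A^T, and A A^T = P A A^T = X A^T A A^T = P. *)
Lemma Gr_frame (n d : nat) (P : 'M[R]_n) : Gr R d n P ->
  exists2 A, Stiefel R d n A & A *m A^T = P.
Proof.
move=> PGr; have [A A1 PA] := orthonormal_fixed PGr (leqnn d).
have [PT PP Pd] := PGr; exists A => //.
have AP : A^T *m P = A^T by rewrite -[P]PT -trmx_mul PA.
have Ad : \rank A^T = d.
  apply/eqP; rewrite eqn_leq rank_leq_row /= -[X in (X <= _)%N](mxrank1 R d) -A1.
  exact: mxrankM_maxl.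
have /submxP[X XP] : (P <= A^T)%MS.
  have AsP : (A^T <= P)%MS by rewrite -AP submxMl.
  by have := mxrank_leqif_sup AsP; rewrite Ad Pd => -[_]; rewrite eqxx.
by rewrite -{1}PA {1}XP -!mulmxA (mulmxA A^T) A1 mul1mx.
Qed.

Lemma frame_Gr (n d : nat) (A : 'M[R]_(n, d)) :
  A^T *m A = 1%:M -> Gr R d n (A *m A^T).
Proof.
move=> A1; split; first by rewrite trmx_mul trmxK.
  by rewrite -mulmxA (mulmxA A^T) A1 mul1mx.
apply/eqP; rewrite eqn_leq (leq_trans (mxrankM_maxl _ _)) ?rank_leq_col//=.
rewrite -[X in (X <= _)%N](mxrank1 R d) -[1%:M]mulmx1 -A1 {1}A1 mul1mx.
(* The identity factors through A A^T, which therefore has rank at least d. *)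
have -> : A^T *m A = A^T *m (A *m A^T) *m A.
  by rewrite !mulmxA A1 mul1mx A1.
exact: leq_trans (mxrankM_maxl _ _) (mxrankM_maxr _ _).
Qed.

(** * Polar decomposition and the optimal rotation between two frames *)

(** O(d) is compact and the trace is continuous. Matrices are flattened to row vectors in order to
    sit in a product of segments, compact by [rV_compact]. *)
Lemma orthogonal_max (d : nat) (M : 'M[R]_d) :
  exists2 W, orthogonal_group R d W &
    forall W', orthogonal_group R d W' -> \tr (W'^T *m M) <= \tr (W^T *m M).
Proof.
pose vm := @vec_mx R d d.
have cvm : mx_continuous vm.
  by move=> i j; under eq_fun do rewrite mxE; exact: coord_continuous.
pose A := [set v : 'rV[R]_(d * d) | orthogonal_group R d (vm v)].
pose f v : R := \tr ((vm v)^T *m M).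
have cf : continuous f.
  apply: continuous_sum => i.
  apply: (@mx_continuousM _ _ _ _ _ (fun v => (vm v)^T) (fun=> M)).
    exact: mx_continuous_tr.
  exact: mx_continuous_cst.
have clA : closed A.
  have -> : A = \bigcap_ij
      [set v | ((vm v)^T *m vm v) ij.1 ij.2 = (1%:M : 'M[R]_d) ij.1 ij.2].
    apply/seteqP; split=> [v Av ij _|v Av] /=; first by rewrite Av.
    by apply/matrixP => i j; exact: (Av (i, j)).
  apply: closed_bigI => -[i j] _ /=.
  apply: (@preimage_closed _ _ (fun v => ((vm v)^T *m vm v) i j)
    [set (1%:M : 'M[R]_d) i j]).
    by move=> v _; apply: mx_continuousM => //; exact: mx_continuous_tr.
  exact: closed_eq.
have cA : compact A.
  apply: subclosed_compact clA (@rV_compact R _ (fun=> `[(-1), 1]%classic) _) _.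
    by move=> _; exact: segment_compact.
  move=> v /= Av i; case/mxvec_indexP: i => i j.
  (* The columns are unit vectors, so all entries lie in [-1, 1]. *)
  have h : \sum_k vm v k j ^+ 2 = 1.
    have := congr1 (fun X : 'M[R]_d => X j j) Av; rewrite /= !mxE eqxx mulr1n => <-.
    by apply: eq_bigr => k _; rewrite [_^T _ _]mxE expr2.
  have : vm v i j ^+ 2 <= 1.
    by rewrite -h (bigD1 i)//= lerDl; apply: sumr_ge0 => k _; exact: sqr_ge0.
  rewrite -real_normK ?num_real// expr_le1// ler_norml => h1.
  by rewrite in_itv /=; move: h1; rewrite mxE.
have A0 : A !=set0.
  by exists (mxvec 1%:M); rewrite /A /= /orthogonal_group /= /vm mxvecK trmx1 mul1mx.
have [v] := compact_EVT_max A0 cA (continuous_subspaceT cf).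
rewrite inE => Av vmax; exists (vm v) => // W' W'1.
by have := vmax (mxvec W'); rewrite /f /vm mxvecK; apply; rewrite inE /A /= /vm mxvecK.
Qed.

Lemma mxtrace_delta_mulmx (d : nat) (S : 'M[R]_d) i j :
  \tr (delta_mx i j *m S) = S j i.
Proof.
rewrite -(mul_delta_mx (0 : 'I_1)) -mulmxA -rowE mxtrace_mulC -colE.
by rewrite trace_mx11 !mxE.
Qed.

(** The reflection in the hyperplane orthogonal to v. Multiplying S by it lowers the trace by 2 v^T
    S v / |v|^2, which tests the positivity of S along v. *)
Lemma householder_orthogonal (d : nat) (v : 'cV[R]_d) : v != 0 ->
  orthogonal_group R d (1%:M - (2 / frob v ^+ 2) *: (v *m v^T)).
Proof.
move=> v0; set q := frob v ^+ 2; have q0 : q != 0.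
  by rewrite expf_neq0//; apply: contra_neq v0; exact: frob_eq0.
have vv : v^T *m v = q%:M by rewrite [LHS]mx11_scalar -trace_mx11 -frob_sqr.
have VT : (1%:M - (2 / q) *: (v *m v^T))^T = 1%:M - (2 / q) *: (v *m v^T).
  by rewrite linearB linearZ /= trmx1 trmx_mul trmxK.
rewrite /orthogonal_group /= VT mulmxBl mul1mx mulmxBr mulmx1 -scalemxAl -scalemxAr.
rewrite mulmxA -(mulmxA v) vv mul_mx_scalar -scalemxAl !scalerA.
have -> : 2 / q * (2 / q * q) = 2 / q + 2 / q by field.
by rewrite scalerDl opprB addrK subrK.
Qed.

(* J is a complex structure on its range, where the matrix below is the rotation of
   angle 2 arctan x. *)
Lemma rotation_orthogonal (d : nat) (J : 'M[R]_d) (x : R) :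
  J^T = - J -> J *m J *m J = - J ->
  orthogonal_group R d
    (1%:M + (2 * x / (1 + x ^+ 2)) *: J + (2 * x ^+ 2 / (1 + x ^+ 2)) *: (J *m J)).
Proof.
move=> JT J3; set s := _ / _; set t := _ / _.
have x0 : 1 + x ^+ 2 != 0 by rewrite gt_eqF// ltr_pwDl// sqr_ge0.
have st : t + t = s * s + t * t by rewrite /s /t; field.
rewrite /orthogonal_group /=; set K := J *m J in J3 *.
have KT : K^T = K by rewrite trmx_mul JT mulmxN mulNmx opprK.
have JK : J *m K = - J by rewrite mulmxA.
have KK : K *m K = - K by rewrite {2}/K mulmxA J3 mulNmx.
have -> : (1%:M + s *: J + t *: K)^T = 1%:M - s *: J + t *: K.
  by rewrite !linearD /= !linearZ /= trmx1 JT KT scalerN.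
rewrite !mulmxDl !mulmxDr !mul1mx !mulmx1 !mulNmx -!scalemxAl -!scalemxAr.
rewrite -/K J3 JK KK; clearbody K; apply/matrixP => i j; rewrite !mxE.
have := congr1 ( *%R^~ (K i j)) st; rewrite /=; lra.
Qed.

(* At a maximiser of tr(W^T M), comparing with nearby rotations shows that W^T M is
   symmetric, and comparing with reflections that it is positive. *)
Lemma polar_decomposition (d : nat) (M : 'M[R]_d) :
  exists2 W, orthogonal_group R d W &
    (W^T *m M)^T = W^T *m M /\
    forall p (X : 'M[R]_(d, p)), 0 <= \tr (X^T *m (W^T *m M) *m X).
Proof.
have [W W1 Wmax] := orthogonal_max M; exists W => //; set S := W^T *m M.
have Smax V : orthogonal_group R d V -> \tr (V^T *m S) <= \tr S.
  move=> V1; rewrite /S mulmxA -trmx_mul; apply: Wmax.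
  by rewrite /orthogonal_group /= trmx_mul -mulmxA (mulmxA W^T) W1 mul1mx.
split.
  apply/matrixP => i j; rewrite mxE; have [->//|ij] := eqVneq i j.
  (* The infinitesimal rotation in the plane of the coordinates i and j; its trace against S is the
     defect of symmetry S j i - S i j. *)
  pose J : 'M[R]_d := delta_mx i j - delta_mx j i.
  have JT : J^T = - J by rewrite linearB /= !trmx_delta opprB.
  have J3 : J *m J *m J = - J.
    rewrite /J !(mulmxBl, mulmxBr) !mul_delta_mx_cond !eqxx (negbTE ij) eq_sym (negbTE ij).
    rewrite !mulr0n !mulr1n !(mul0mx, subr0, sub0r).
    rewrite !mul_delta_mx_cond !eqxx (negbTE ij) eq_sym (negbTE ij) !mulr0n !mulr1n.
    by rewrite !(mul0mx, subr0, sub0r, opprK, oppr0, add0r, addr0) opprB addrC.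
  have trJ : \tr (J *m S) = S j i - S i j.
    by rewrite mulmxBl linearB /= !mxtrace_delta_mulmx.
  apply/eqP; rewrite -subr_eq0 -trJ; move: J JT J3 {trJ} => J JT J3; apply/eqP.
  set a := \tr _; pose b := \tr (J *m J *m S).
  have ab x : x ^+ 2 * b <= x * a.
    have := Smax _ (rotation_orthogonal x JT J3).
    rewrite 2!(linearD (@trmx R d d)) /= !trmx_scale trmx1 trmx_mul JT.
    rewrite mulmxN mulNmx opprK scalerN.
    rewrite !mulmxDl mul1mx mulNmx -!scalemxAl !mxtraceD linearN /= !mxtraceZ -/b -/a => h.
    have x0 : 0 < 1 + x ^+ 2 by rewrite ltr_pwDl// sqr_ge0.
    have : 0 <= 2 / (1 + x ^+ 2) * (x * a - x ^+ 2 * b) by move: h; lra.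
    by rewrite pmulr_rge0 ?subr_ge0// divr_gt0.
  have B0 : 0 < `|b| + 1 by rewrite ltr_wpDl.
  (* Near 0 the linear term dominates the quadratic one, which forces a = 0: this value of x gives
     a^2 (b + |b| + 1) <= 0, where the second factor is at least 1. *)
  have := ab (- (a / (`|b| + 1))).
  rewrite sqrrN expr_div_n mulNr [X in _ <= - X]mulrAC -expr2.
  have := ler_norm (- b); rewrite normrN => bb h.
  have {}h : a ^+ 2 * (b + (`|b| + 1)) <= 0.
    move: h; rewrite -(ler_pM2r (exprn_gt0 2 B0)).
    have -> : a ^+ 2 / (`|b| + 1) ^+ 2 * b * (`|b| + 1) ^+ 2 = a ^+ 2 * b.
      by field; rewrite gt_eqF.
    have -> : - (a ^+ 2 / (`|b| + 1)) * (`|b| + 1) ^+ 2 = - (a ^+ 2 * (`|b| + 1)).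
      by field; rewrite gt_eqF.
    by rewrite mulrDr; lra.
  apply/eqP; rewrite -sqrf_eq0 eq_le sqr_ge0 andbT.
  by move: h; rewrite pmulr_lle0//; lra.
have Spos (v : 'cV[R]_d) : 0 <= \tr (v^T *m S *m v).
  have [->|v0] := eqVneq v 0; first by rewrite mulmx0 mxtrace0.
  have := Smax _ (householder_orthogonal v0).
  rewrite (linearB (@trmx R d d)) /= trmx_scale trmx1 trmx_mul trmxK.
  rewrite mulmxBl mul1mx -scalemxAl.
  rewrite linearB /= mxtraceZ gerBl -(mulmxA v) (mxtrace_mulC v) pmulr_rge0//.
  rewrite divr_gt0// exprn_gt0// lt_def frob_ge0 andbT.
  by apply: contra_neq v0; exact: frob_eq0.
(* The trace is the sum of the quadratic form of S over the columns of X. *)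
move=> p X; rewrite /mxtrace; apply: sumr_ge0 => j _.
have := Spos (col j X); rewrite trace_mx11; congr (_ <= _).
by rewrite tr_col -!row_mul [col j X]colE mulmxA -colE mxE mxE.
Qed.

(** The difference of the squares is the squared norm of Y - F F^T Y, the part of Y orthogonal to
    the range of F. *)
Lemma frob_trmx_mulmx_le (m n d : nat) (F : 'M[R]_(m, d)) (Y : 'M[R]_(m, n)) :
  F^T *m F = 1%:M -> frob (F^T *m Y) <= frob Y.
Proof.
move=> F1; rewrite -(@ler_pXn2r _ 2)// ?nnegrE ?frob_ge0//.
have := sqr_ge0 (frob (Y - F *m (F^T *m Y))).
rewrite frob_sqrB frob_mulmxl// mulmxA.
have -> : Y^T *m F *m (F^T *m Y) = (F^T *m Y)^T *m (F^T *m Y).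
  by rewrite trmx_mul trmxK.
rewrite -frob_sqr; lra.
Qed.

(** For the polar factor W of F^T G, the matrix S = W^T F^T G is symmetric and positive, and the
    inequality between the squares becomes tr(S^2) <= tr(S). It holds because the eigenvalues of S
    are cosines in [0, 1]; the proof uses trace inequalities instead of diagonalising S. *)
Lemma procrustes (m d : nat) (F G : 'M[R]_(m, d)) :
  F^T *m F = 1%:M -> G^T *m G = 1%:M ->
  exists2 W, orthogonal_group R d W &
    frob (F *m W - G) <= frob (F *m F^T - G *m G^T).
Proof.
move=> F1 G1; have [W W1 [ST Spos]] := polar_decomposition (F^T *m G).
exists W => //; rewrite -(@ler_pXn2r _ 2)// ?nnegrE ?frob_ge0//.
have W1' : W *m W^T = 1%:M by apply: mulmx1C.
rewrite frob_frameB_sqr// frob_projB_sqr// -mulmxA.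
have -> : frob (F^T *m G) = frob (W^T *m (F^T *m G)) by rewrite [RHS]frob_mulmxl// trmxK.
(* 0 <= tr((1 - S) S (1 - S)) and tr(S^3) <= tr(S^2) give tr(S^2) <= tr(S). *)
move: ST Spos; set S := W^T *m _ => ST Spos.
have SS : frob (S *m S) <= frob S.
  rewrite {1}/S -mulmxA frob_mulmxl ?trmxK// -mulmxA.
  by rewrite (le_trans (frob_trmx_mulmx_le _ F1))// frob_mulmxl.
have SSS : \tr (S *m (S *m S)) <= frob S ^+ 2.
  rewrite -[X in \tr (X *m _)]ST (le_trans (mxtrace_dot_le _ _))// expr2.
  by rewrite ler_wpM2l ?frob_ge0.
have := Spos _ (1%:M - S).
rewrite (linearB (@trmx R d d)) /= trmx1 ST mulmxBl mul1mx mulmxBr mulmx1 mulmxBl.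
rewrite !linearB /= -mulmxA.
have -> : \tr (S *m S) = frob S ^+ 2 by rewrite frob_sqr ST.
lra.
Qed.

End OrthonormalFrames.

(** * Homotopy and finitely supported matrices *)

Section HomotopyRelation.
Variables (R : realType) (T U : topologicalType).

Lemma within_continuous_comp (S1 S2 : topologicalType) (A : set S1) (B : set S2)
    (h : S1 -> S2) (f : S2 -> U) :
  continuous h -> (forall x, A x -> B (h x)) ->
  {within B, continuous f} -> {within A, continuous (f \o h)}.
Proof.
move=> ch hAB /subspace_continuousP cf; apply/subspace_continuousP => x Ax.
apply: cvg_trans (cf _ (hAB _ Ax)) => V /= hV.
rewrite /within /=; have := ch x _ hV; rewrite !near_simpl /=.
by apply: filterS => y /= hy Ay; apply: hy; exact: hAB.
Qed.

Lemma continuous_fst : continuous (@fst T R).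
Proof. by move=> [x y]; exact: cvg_fst. Qed.

Lemma continuous_snd : continuous (@snd T R).
Proof. by move=> [x y]; exact: cvg_snd. Qed.

Lemma continuous_reparam (u : R -> R) : continuous u ->
  continuous (fun p : T * R => (p.1, u p.2)).
Proof.
move=> cu p.
apply: (@cvg_pair _ _ _ _ (nbhs p.1) (nbhs (u p.2))); first exact: continuous_fst.
by apply: (@continuous_comp _ _ _ snd u); [exact: continuous_snd|exact: cu].
Qed.

Variable B : set U.

Lemma homotopic_sym (f g : T -> U) : homotopic R B f g -> homotopic R B g f.
Proof.
move=> [H [cH HB H0 H1]]; exists (H \o (fun p => (p.1, 1 - p.2))); split.
- apply: within_continuous_comp cH.
    apply: (@continuous_reparam (fun s => 1 - s)) => s.
    by apply: (@continuousB R R R); [exact: cst_continuous|exact: cvg_id].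
  by move=> [t s] /= [_]; rewrite !in_itv /= => s01; split => //; lra.
- by move=> t s /=; rewrite in_itv /= => s01; apply: HB; rewrite in_itv /=; lra.
- by move=> t /=; rewrite subr0.
- by move=> t /=; rewrite subrr.
Qed.

Lemma homotopic_trans (f g h : T -> U) :
  homotopic R B f g -> homotopic R B g h -> homotopic R B f h.
Proof.
move=> [H [cH HB H0 H1]] [G [cG GB G0 G1]].
pose L (p : T * R) := if p.2 <= 2^-1 then H (p.1, 2 * p.2) else G (p.1, 2 * p.2 - 1).
have clS (I : set R) : closed I -> closed ([set: T] `*` I).
  move=> cI; have -> : [set: T] `*` I = snd @^-1` I.
    by apply/seteqP; split => [[x y] []|[x y]].
  by apply: preimage_closed => // x _; exact: continuous_snd.
exists L; split.
- have -> : [set: T] `*` `[0, 1]%classic =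
      ([set: T] `*` `[0, 2^-1]%classic) `|` ([set: T] `*` `[2^-1, (1 : R)]%classic).
    apply/seteqP; split => [[t s] /= [_]|[t s] /= []]; rewrite /= !in_itv /=.
    + by case: (leP s 2^-1) => s2 s01; [left|right]; split => //; lra.
    + by move=> [_ s01]; split => //; lra.
    + by move=> [_ s01]; split => //; lra.
  have c2 : continuous (fun s : R => 2 * s).
    exact: mulrl_continuous.
  apply: withinU_continuous.
  + by apply: clS; exact: itv_closed.
  + by apply: clS; exact: itv_closed.
  + apply: (@subspace_eq_continuous _ _ _ (H \o (fun p => (p.1, 2 * p.2)))).
      move=> [t s]; rewrite inE /= => -[_]; rewrite /= in_itv /= => /andP[_ s2].
      by rewrite /from_subspace /L /= s2.
    apply: within_continuous_comp cH; first exact: (@continuous_reparam (fun s => 2 * s)).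
    by move=> [t s] /= [_]; rewrite !in_itv /= => s01; split => //; lra.
  + apply: (@subspace_eq_continuous _ _ _ (G \o (fun p => (p.1, 2 * p.2 - 1)))).
      move=> [t s]; rewrite inE /= => -[_]; rewrite /= in_itv /= => /andP[s2 _].
      (* The two closed halves overlap at s = 1/2, where both homotopies give g. *)
      rewrite /from_subspace /L /=; case: leP => // s2'.
      have -> : s = 2^-1 by lra.
      by rewrite mulfV// subrr G0 H1.
    apply: within_continuous_comp cG.
      apply: (@continuous_reparam (fun s => 2 * s - 1)) => s.
      apply: (@continuousB R R R); first exact: c2.
      exact: cst_continuous.
    by move=> [t s] /= [_]; rewrite !in_itv /= => s01; split => //; lra.
- move=> t s; rewrite in_itv /= /L /= => s01; case: leP => s2.
    by apply: HB; rewrite in_itv /=; lra.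
  by apply: GB; rewrite in_itv /=; lra.
- by move=> t; rewrite /L /= invr_ge0 ler0n mulr0.
- move=> t; rewrite /L /=; have -> : (1 <= 2^-1 :> R) = false by apply/negbTE; lra.
  by rewrite mulr1 (_ : 2 - 1 = 1 :> R)//; lra.
Qed.

End HomotopyRelation.

Section FinSuppFrobenius.
Variable R : realType.

(** The injections u and v cut out a finite block containing the support of A. This transfers the
    norm to finite matrices for both [padding] and [rows_from 0]. *)
Lemma fs_frob_ord (I J : choiceType) (m n : nat) (u : 'I_m -> I) (v : 'I_n -> J)
    (A : fsmx R I J) :
  injective u -> injective v ->
  (forall k l, A k l != 0 -> exists i j, u i = k /\ v j = l) ->
  fs_frob A = frob (\matrix_(i, j) (A (u i) (v j) : R)).
Proof.
move=> uI vI Auv; rewrite /fs_frob /frob; congr Num.sqrt.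
pose uv (ij : 'I_m * 'I_n) := (u ij.1, v ij.2).
have -> : \sum_(p \in [set: I * J]) A p.1 p.2 ^+ 2 =
    \sum_(p \in range uv) A p.1 p.2 ^+ 2.
  apply/esym/fsbig_widen => // -[k l] [_] /= nuv.
  apply/eqP; rewrite sqrf_eq0; apply: contra_notT nuv => /Auv[i [j [<- <-]]].
  by exists (i, j).
rewrite (@reindex_fsbig _ _ _ _ _ uv setT); last first.
  split; [by move=> x _; exists x| |by []].
  by move=> [i j] [i' j'] _ _ /= [] /uI -> /vI ->.
rewrite (@fsbigE _ _ _ _ _ (index_enum _)) ?index_enum_uniq//; last first.
  by move=> ij _; rewrite mem_index_enum.
rewrite big_mkcond /= pair_bigA /=; apply: eq_bigr => ij _.
by rewrite mxE in_setT.
Qed.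

Lemma padding_ord (n : nat) (M : 'M[R]_n) (i j : 'I_n) : padding M i j = M i j.
Proof.
rewrite /= /padding_fun (big_pred1 i) => [|k]; last by rewrite eq_sym.
by rewrite (big_pred1 j) => [//|k]; rewrite eq_sym.
Qed.

Lemma padding_neq0 (n : nat) (M : 'M[R]_n) k l : padding M k l != 0 ->
  exists i j : 'I_n, i = k :> nat /\ j = l :> nat.
Proof.
move=> h; have [i ik|nk] := pickP (fun i : 'I_n => i == k :> nat); last first.
  by move: h; rewrite /= /padding_fun big_pred0 ?eqxx.
have [j jl|nl] := pickP (fun j : 'I_n => j == l :> nat); last first.
  move: h; rewrite /= /padding_fun big1 ?eqxx// => i' _.
  by rewrite big_pred0.
by exists i, j; split; exact/eqP.
Qed.

Lemma padding_linear n : linear (@padding R n).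
Proof.
move=> a M N; apply/val_inj/funext => k; apply/funext => l /=.
rewrite !fctE /= /padding_fun scaler_sumr -big_split /=.
apply: eq_bigr => i _; rewrite scaler_sumr -big_split /=.
by apply: eq_bigr => j _; rewrite !mxE.
Qed.

HB.instance Definition _ n := GRing.isLinear.Build R 'M[R]_n (fsmx R nat nat)
  _ (@padding R n) (@padding_linear n).

Lemma fs_frob_padding (n : nat) (M : 'M[R]_n) : fs_frob (padding M) = frob M.
Proof.
rewrite (@fs_frob_ord _ _ n n val val) ?(@val_inj _ _ 'I_n)//.
  by congr frob; apply/matrixP => i j; rewrite mxE padding_ord.
by move=> k l /padding_neq0.
Qed.

Lemma padding_continuous n : continuous (@padding R n).
Proof. by apply/continuousP => U oU; exact: oU. Qed.

Lemma rows_from_linear n d s : linear (@rows_from R n d s).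
Proof.
move=> a M N; apply/val_inj/funext => k; apply/funext => l /=.
rewrite !fctE /= /rows_from_fun scaler_sumr -big_split /=.
by apply: eq_bigr => i _; rewrite !mxE.
Qed.

HB.instance Definition _ n d s := GRing.isLinear.Build R 'M[R]_(n, d)
  (fsmx R nat 'I_d) _ (@rows_from R n d s) (@rows_from_linear n d s).

Lemma rows_from0_ord (n d : nat) (A : 'M[R]_(n, d)) (i : 'I_n) (a : 'I_d) :
  rows_from 0 A i a = A i a.
Proof.
by rewrite /= /rows_from_fun (big_pred1 i).
Qed.

Lemma rows_from0_neq0 (n d : nat) (A : 'M[R]_(n, d)) k a :
  rows_from 0 A k a != 0 -> exists i : 'I_n, i = k :> nat.
Proof.
move=> h; have [i ik|nk] := pickP (fun i : 'I_n => i == k :> nat); last first.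
  by move: h; rewrite /= /rows_from_fun big_pred0 ?eqxx.
by exists i; exact/eqP.
Qed.

Lemma fs_frob_rows_from0 (n d : nat) (A : 'M[R]_(n, d)) :
  fs_frob (rows_from 0 A) = frob A.
Proof.
rewrite (@fs_frob_ord _ _ n d val id) ?(@val_inj _ _ 'I_n)//.
  by congr frob; apply/matrixP => i j; rewrite mxE rows_from0_ord.
by move=> k a /rows_from0_neq0[i ik]; exists i, a.
Qed.

Lemma fs_mulmx_rows_from (n d s : nat) (A : 'M[R]_(n, d)) (W : 'M[R]_d) :
  fs_mulmx (rows_from s A) W = rows_from s (A *m W).
Proof.
apply/val_inj/funext => k; apply/funext => a /=.
rewrite /fs_mulmx_fun /rows_from_fun /=.
under eq_bigr do rewrite mulr_suml.
by rewrite exchange_big /=; apply: eq_bigr => i _; rewrite mxE.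
Qed.

Lemma gram_rows_from0 (n d : nat) (A : 'M[R]_(n, d)) :
  gram (rows_from 0 A) = padding (A *m A^T).
Proof.
apply/val_inj/funext => k; apply/funext => l /=.
rewrite /gram_fun /padding_fun /rows_from_fun /=.
under eq_bigr do rewrite mulr_suml.
rewrite exchange_big /=; apply: eq_bigr => i _.
under eq_bigr do rewrite mulr_sumr.
rewrite exchange_big /=; apply: eq_bigr => j _.
by rewrite !mxE; apply: eq_bigr => a _; rewrite mxE.
Qed.

(** For s + d <= m, this is the isometric inclusion of R^d as the coordinates s, ..., s + d - 1 of
    R^m. It turns the placing of blocks into matrix products inside one finite R^m. *)
Definition row_shift (m d s : nat) : 'M[R]_(m, d) :=
  \matrix_(k, b) ((s + b)%N == k)%:R.

Lemma rows_from_shift (m n d s : nat) (M : 'M[R]_(n, d)) : (s + n <= m)%N ->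
  rows_from s M = rows_from 0 (row_shift m n s *m M).
Proof.
move=> snm; apply/val_inj/funext => k; apply/funext => a /=.
rewrite /rows_from_fun /=; under [RHS]eq_bigr do rewrite mxE.
rewrite exchange_big /= big_mkcond /=; apply: eq_bigr => b _.
rewrite -mulr_suml; have [sbk|sbk] := eqVneq (s + b)%N k.
  have km : (k < m)%N by rewrite -sbk (leq_trans _ snm)// ltn_add2l.
  rewrite (big_pred1 (Ordinal km)); last by move=> i.
  by rewrite mxE /= sbk eqxx mul1r.
rewrite big1 ?mul0r// => i /eqP; rewrite add0n => ik.
by rewrite mxE ik (negbTE sbk).
Qed.

Lemma row_shift_orthonormal (m n s : nat) : (s + n <= m)%N ->
  (row_shift m n s)^T *m row_shift m n s = 1%:M.
Proof.
move=> snm; apply/matrixP => a b; rewrite !mxE.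
have km : (s + a < m)%N by rewrite (leq_trans _ snm)// ltn_add2l.
rewrite (bigD1 (Ordinal km))//= !mxE /= eqxx mul1r eqn_add2l eq_sym.
rewrite big1 ?addr0// => i ik; rewrite !mxE.
case: eqVneq => [ski|]; last by rewrite mul0r.
by move: ik; rewrite -val_eqE /= ski eqxx.
Qed.

Lemma row_shift_disjoint (m n n' s s' : nat) : (s + n <= s')%N ->
  (row_shift m n s)^T *m row_shift m n' s' = 0.
Proof.
move=> ss'; apply/matrixP => a b; rewrite !mxE big1// => i _; rewrite !mxE.
case: eqVneq => [ski|]; last by rewrite mul0r.
rewrite mul1r; case: eqVneq => // s'i.
have := leq_trans ss' (leq_addr b s').
by rewrite s'i -ski leq_add2l leqNgt ltn_ord.
Qed.

End FinSuppFrobenius.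

(** * Stacked frames and the comparison homotopy *)

Section FrameHomotopy.
Variables (R : realType) (d : nat).

Lemma frob_sqr_comb (m n : nat) (a b : R) (X Y : 'M[R]_(m, n)) : X^T *m Y = 0 ->
  frob (a *: X + b *: Y) ^+ 2 = a ^+ 2 * frob X ^+ 2 + b ^+ 2 * frob Y ^+ 2.
Proof.
move=> XY; rewrite frob_sqrD trmx_scale -scalemxAl -scalemxAr XY !scaler0 mxtrace0.
by rewrite mulr0 addr0 !frobZ !exprMn !real_normK ?num_real.
Qed.

Lemma partition_of_unity_comb (V : finType) (T : topologicalType)
    (w0 w1 : V -> T -> R) (s : R) (t : T) : 0 <= s <= 1 ->
  partition_of_unity w0 -> partition_of_unity w1 ->
  (forall i, 0 <= (1 - s) * w0 i t + s * w1 i t) /\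
  \sum_i ((1 - s) * w0 i t + s * w1 i t) = 1.
Proof.
move=> /andP[s0 s1] [_ w00 w01] [_ w10 w11]; split=> [i|].
  by rewrite addr_ge0// mulr_ge0// subr_ge0.
by rewrite big_split /= -!mulr_sumr w01 w11; ring.
Qed.

(** The weights are interpolated linearly and the frames with square roots. The error F_i W_ik - F_k
    is a combination of the errors of A and B, which are orthogonal, so by Pythagoras its square is
    a convex combination of two numbers below rho^2; [frob_proj_le] then bounds the distance of the
    projections. *)
Lemma frame_homotopy (V : finType) (T : topologicalType) (st : V -> set T)
    (m : nat) (rho : R) (w0 w1 : V -> T -> R) (A B : V -> T -> 'M[R]_(m, d))
    (W : V -> V -> 'M[R]_d) :
  partition_of_unity w0 -> subordinate w0 st ->
  partition_of_unity w1 -> subordinate w1 st ->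
  (forall i, mx_continuous (A i)) -> (forall i, mx_continuous (B i)) ->
  (forall i t, st i t -> (A i t)^T *m A i t = 1%:M) ->
  (forall i t, st i t -> (B i t)^T *m B i t = 1%:M) ->
  (forall i j t, (A i t)^T *m B j t = 0) ->
  (forall i j t, st i t -> st j t ->
     [/\ orthogonal_group R d (W i j),
         frob (A i t *m W i j - A j t) < rho &
         frob (B i t *m W i j - B j t) < rho]) ->
  homotopic R (Gr_oo_nbhd d (Num.sqrt 2 * rho))
    (fun t => padding (\sum_i w0 i t *: (A i t *m (A i t)^T)))
    (fun t => padding (\sum_i w1 i t *: (B i t *m (B i t)^T))).
Proof.
move=> pw0 sw0 pw1 sw1 cA cB A1 B1 AB AW.
pose F i (p : T * R) := Num.sqrt (1 - p.2) *: A i p.1 + Num.sqrt p.2 *: B i p.1.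
pose w i (p : T * R) := (1 - p.2) * w0 i p.1 + p.2 * w1 i p.1.
pose M p := \sum_i w i p *: (F i p *m (F i p)^T).
have c1 (f : T -> R) : continuous f -> continuous (fun p : T * R => f p.1).
  by move=> cf p; apply: (@continuous_comp _ _ _ fst f); [exact: continuous_fst|exact: cf].
have c2 (f : R -> R) : continuous f -> continuous (fun p : T * R => f p.2).
  by move=> cf p; apply: (@continuous_comp _ _ _ snd f); [exact: continuous_snd|exact: cf].
have cN : continuous (fun s : R => 1 - s).
  by move=> s; apply: (@continuousB R R R); [exact: cst_continuous|exact: cvg_id].
have csN : continuous (fun s : R => Num.sqrt (1 - s)).
  move=> s; apply: (@continuous_comp _ _ _ (fun s : R => 1 - s) (@Num.sqrt R)).
    exact: cN.
  exact: sqrt_continuous.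
have cF i : mx_continuous (F i).
  apply: mx_continuousD.
    apply: (@mx_continuousZ _ _ _ _ (fun p : T * R => Num.sqrt (1 - p.2)) (fun p => A i p.1)).
      exact: (c2 (fun s => Num.sqrt (1 - s)) csN).
    by move=> k l; exact: (c1 (fun t => A i t k l) (cA i k l)).
  apply: (@mx_continuousZ _ _ _ _ (fun p : T * R => Num.sqrt p.2) (fun p => B i p.1)).
    by apply: (c2 (fun s => Num.sqrt s)); exact: sqrt_continuous.
  by move=> k l; exact: (c1 (fun t => B i t k l) (cB i k l)).
have cw i : continuous (w i).
  have [[cw0 _ _] [cw1 _ _]] := (pw0, pw1).
  have cwi : continuous (fun p : T * R => (1 - p.2) * w0 i p.1).
    move=> p; apply: (@continuousM R (T * R)%type (fun p => 1 - p.2) (fun p => w0 i p.1)).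
      exact: (c2 (fun s => 1 - s) cN).
    exact: (c1 _ (cw0 i)).
  move=> p; apply: (@continuousD R R (T * R)%type _ _ p (cwi p)).
  apply: (@continuousM R (T * R)%type (fun p => p.2) (fun p => w1 i p.1)).
    exact: continuous_snd.
  exact: (c1 _ (cw1 i)).
have cM : continuous (fun p => padding (M p)).
  move=> p; apply: (@continuous_comp _ _ _ M (@padding R m)); last exact: padding_continuous.
  apply: mx_continuousP; apply: mx_continuous_sum => i.
  apply: mx_continuousZ => //.
  apply: (@mx_continuousM _ _ _ _ _ (F i) (fun p => (F i p)^T)) => //.
  exact: mx_continuous_tr.
exists (fun p => padding (M p)); split.
- exact: continuous_subspaceT.
- move=> t s; rewrite in_itv /= => s01; have /andP[s0 s1] := s01.
  have [wge0 wsum] := partition_of_unity_comb t s01 pw0 pw1.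
  (* F_k F_k^T, for any vertex k of nonzero weight, is the point of the Grassmannian to which the
     average is compared. *)
  have [k wk] := cvx_neq0 wsum.
  have wst i : w i (t, s) != 0 -> st i t.
    rewrite /w /= => wi; have [w0i|w0i] := eqVneq (w0 i t) 0; last exact: sw0.
    apply: sw1; apply: contra_neq wi => ->; rewrite w0i; ring.
  have sq1 : Num.sqrt (1 - s) ^+ 2 = 1 - s by rewrite sqr_sqrtr ?subr_ge0.
  have sq2 : Num.sqrt s ^+ 2 = s by rewrite sqr_sqrtr.
  have F1 i : st i t -> (F i (t, s))^T *m F i (t, s) = 1%:M.
    move=> sti; rewrite /F /= (linearD (@trmx R m d)) /= !trmx_scale mulmxDl !mulmxDr.
    rewrite -!scalemxAl -!scalemxAr A1// B1// AB.
    rewrite -[(B i t)^T *m A i t]trmxK trmx_mul trmxK AB trmx0.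
    rewrite !scaler0 addr0 add0r !scalerA -!expr2 sq1 sq2 -scalerDl subrK scale1r.
    by [].
  have FW i : st i t -> frob (F i (t, s) *m (F i (t, s))^T -
      F k (t, s) *m (F k (t, s))^T) < Num.sqrt 2 * rho.
    move=> sti; have stk := wst _ wk; have [W1 hA hB] := AW _ _ _ sti stk.
    apply: le_lt_trans (frob_proj_le (F1 _ sti) (F1 _ stk) W1) _.
    rewrite ltr_pM2l ?sqrtr_gt0//.
    have rho0 : 0 < rho := le_lt_trans (frob_ge0 _) hA.
    rewrite -(@ltr_pXn2r _ 2)// ?nnegrE ?frob_ge0 ?ltW//.
    have -> : F i (t, s) *m W i k - F k (t, s) =
        Num.sqrt (1 - s) *: (A i t *m W i k - A k t) +
        Num.sqrt s *: (B i t *m W i k - B k t).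
      by rewrite /F /= mulmxDl -!scalemxAl !scalerBr opprD addrACA.
    rewrite frob_sqr_comb; last first.
      rewrite (linearB (@trmx R m d)) /= trmx_mul mulmxBl !mulmxBr -!mulmxA.
      rewrite (mulmxA (A i t)^T (B i t)) (mulmxA (A k t)^T (B i t)) !AB.
      by rewrite !mul0mx !mulmx0 !subr0.
    rewrite sq1 sq2.
    have {}hA : frob (A i t *m W i k - A k t) ^+ 2 < rho ^+ 2.
      by rewrite ltr_pXn2r// ?nnegrE ?frob_ge0 ?ltW.
    have {}hB : frob (B i t *m W i k - B k t) ^+ 2 < rho ^+ 2.
      by rewrite ltr_pXn2r// ?nnegrE ?frob_ge0 ?ltW.
    move: hA hB; move: (frob _ ^+ 2) (frob _ ^+ 2) (rho ^+ 2) => b a c ac bc.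
    (* Strictness comes from the A term if s = 0 and from the B term otherwise. *)
    have [->|sneq0] := eqVneq s 0; first by rewrite subr0 mul1r mul0r addr0.
    have sbc : s * b < s * c by rewrite ltr_pM2l// lt_def sneq0.
    have : (1 - s) * a <= (1 - s) * c by rewrite ler_wpM2l ?subr_ge0 ?(ltW ac).
    by move: sbc; lra.
  exists (padding (F k (t, s) *m (F k (t, s))^T)).
    exists m => //; exists (F k (t, s) *m (F k (t, s))^T) => //.
    exact/frame_Gr/F1/wst.
  rewrite -linearB fs_frob_padding; apply: frob_cvx_lt => // i wi.
  exact/FW/wst.
- move=> t; congr padding; apply: eq_bigr => i _.
  by rewrite /w /F /= subr0 mul1r mul0r addr0 sqrtr1 sqrtr0 scale1r scale0r addr0.
- move=> t; congr padding; apply: eq_bigr => i _.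
  by rewrite /w /F /= subrr mul1r mul0r add0r sqrtr1 sqrtr0 scale1r scale0r add0r.
Qed.

End FrameHomotopy.

Section StackedFrames.
Variables (R : realType) (d : nat) (V : finType) (K : scomplex V).
Variables (Om : V -> V -> 'M[R]_d).

Lemma open_star_face (y : geom R K) (s : {set V}) : s != finset.set0 ->
  (forall i, i \in s -> open_star R K i y) -> face K s.
Proof.
move=> s0 sy; have [_ _ fy] := set_valP y; apply: face_sub fy _ s0.
by apply/fintype.subsetP => i /sy h; rewrite inE gt_eqF.
Qed.

Lemma open_star_edge (y : geom R K) i j :
  open_star R K i y -> open_star R K j y -> edge K i j.
Proof.
move=> yi yj; apply: (@open_star_face y) => [|k].
  by apply/set0Pn; exists i; rewrite !inE eqxx.
by rewrite !inE => /orP[] /eqP ->.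
Qed.

Lemma open_star_triangle (y : geom R K) i j k :
  open_star R K i y -> open_star R K j y -> open_star R K k y -> triangle K i j k.
Proof.
move=> yi yj yk; apply: (@open_star_face y) => [|l].
  by apply/set0Pn; exists i; rewrite !inE eqxx.
by rewrite !inE => /orP[/orP[]|] /eqP ->.
Qed.

(** The frame [cl_frame] cut down to its first m rows, for m large enough to hold all the blocks;
    [cl_map] then becomes the [padding] of a finite matrix. *)
Definition stacked (m : nat) (psi : V -> geom R K -> R) (iota : V -> nat)
    (i : V) (y : geom R K) : 'M[R]_(m, d) :=
  \sum_j Num.sqrt (psi j y) *: (row_shift R m d (d * iota j) *m (Om i j)^T).

Lemma cl_map_stacked (m : nat) psi iota y :
  (forall j, d * iota j + d <= m)%N ->
  cl_map psi iota Om y = padding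
    (\sum_i psi i y *: (stacked m psi iota i y *m (stacked m psi iota i y)^T)).
Proof.
move=> iotam; rewrite linear_sum; apply: eq_bigr => i _.
rewrite linearZ /= -gram_rows_from0; congr (_ *: gram _).
rewrite /stacked linear_sum; apply: eq_bigr => j _.
by rewrite linearZ /= -rows_from_shift.
Qed.

Lemma stacked_continuous (m : nat) psi iota i :
  (forall j, continuous (psi j)) -> mx_continuous (stacked m psi iota i).
Proof.
move=> cpsi; apply: mx_continuous_sum => j; apply: mx_continuousZ.
  move=> y; apply: (@continuous_comp _ _ _ (psi j)); first exact: cpsi.
  exact: sqrt_continuous.
exact: mx_continuous_cst.
Qed.

Lemma row_shift_dot (m : nat) (iota : V -> nat) i j :
  injective iota -> (forall j, d * iota j + d <= m)%N ->
  (row_shift R m d (d * iota i))^T *m row_shift R m d (d * iota j) =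
    ((i == j)%:R)%:M.
Proof.
move=> iotaI iotam; have [->|ij] := eqVneq i j; first exact: row_shift_orthonormal.
rewrite raddf0; have : iota i != iota j by apply: contra_neq ij; exact: iotaI.
rewrite neq_ltn => /orP[] lt_ij.
  by apply: row_shift_disjoint; rewrite addnC -mulnS leq_mul2l lt_ij orbT.
rewrite -[LHS]trmxK trmx_mul trmxK row_shift_disjoint ?trmx0//.
by rewrite addnC -mulnS leq_mul2l lt_ij orbT.
Qed.

(** Distinct blocks are orthogonal, so only the diagonal terms of the double sum survive. *)
Lemma block_dot (m : nat) (E : V -> 'M[R]_(m, d)) (c c' : V -> R)
    (Y Y' : V -> 'M[R]_d) :
  (forall i j, (E i)^T *m E j = ((i == j)%:R)%:M) ->
  (\sum_j c j *: (E j *m Y j))^T *m (\sum_j c' j *: (E j *m Y' j)) =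
  \sum_j (c j * c' j) *: ((Y j)^T *m Y' j).
Proof.
move=> EE; rewrite (linear_sum (@trmx R m d)) /= mulmx_suml; apply: eq_bigr => i _ /=.
rewrite mulmx_sumr (bigD1 i)//= big1 => [|j ji].
  rewrite addr0 trmx_scale -scalemxAl -scalemxAr scalerA trmx_mul.
  by rewrite -mulmxA (mulmxA (E i)^T) EE eqxx mul1mx.
rewrite trmx_scale -scalemxAl -scalemxAr scalerA trmx_mul.
rewrite -mulmxA (mulmxA (E i)^T) EE eq_sym (negbTE ji) raddf0 mul0mx mulmx0.
by rewrite scaler0.
Qed.

(** The Gram matrix is the sum of the psi_j Om_ij Om_ij^T. Where psi_j does not vanish, (ij) is an
    edge and Om_ij is orthogonal, so the sum is that of the psi_j times the identity. *)
Lemma stacked_orthonormal (m : nat) psi iota i y :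
  partition_of_unity psi -> subordinate psi (open_star R K) ->
  injective iota -> (forall j, d * iota j + d <= m)%N ->
  (forall i j, edge K i j -> orthogonal_group R d (Om i j)) ->
  open_star R K i y ->
  (stacked m psi iota i y)^T *m stacked m psi iota i y = 1%:M.
Proof.
move=> [_ psi0 psi1] spsi iotaI iotam OmO yi.
rewrite block_dot; last by move=> ? ?; exact: row_shift_dot.
transitivity (\sum_j psi j y *: (1%:M : 'M[R]_d)); last first.
  by rewrite -scaler_suml psi1 scale1r.
apply: eq_bigr => j _; rewrite -expr2 sqr_sqrtr// trmxK.
have [->|/spsi yj] := eqVneq (psi j y) 0; first by rewrite !scale0r.
by congr (_ *: _); apply: mulmx1C; exact: OmO (open_star_edge yi yj).
Qed.

(** By symmetry of Om, block j of the difference is sqrt(psi_j) (Om_ji Om_ik - Om_jk). The cocycle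
    condition on (jik) makes the squared norm a convex combination of numbers below rho^2. *)
Lemma stacked_witness (m : nat) (rho : R) psi iota i k y :
  partition_of_unity psi -> subordinate psi (open_star R K) ->
  injective iota -> (forall j, d * iota j + d <= m)%N ->
  approx_cocycle K rho Om ->
  open_star R K i y -> open_star R K k y ->
  frob (stacked m psi iota i y *m Om i k - stacked m psi iota k y) < rho.
Proof.
move=> [_ psi0 psi1] spsi iotaI iotam [OmO [OmT Om1] Omrho] yi yk.
(* The degenerate triangle (iii) already forces rho > 0. *)
have rho0 : 0 < rho.
  exact: le_lt_trans (frob_ge0 _) (Omrho _ _ _ (open_star_triangle yi yi yi)).
rewrite -(@ltr_pXn2r _ 2)// ?nnegrE ?frob_ge0 ?ltW//.
have -> : stacked m psi iota i y *m Om i k - stacked m psi iota k y =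
    \sum_j Num.sqrt (psi j y) *: (row_shift R m d (d * iota j) *m
      ((Om i j)^T *m Om i k - (Om k j)^T)).
  rewrite mulmx_suml -sumrB; apply: eq_bigr => j _.
  by rewrite mulmxBr scalerBr mulmxA -scalemxAl.
rewrite frob_sqr block_dot; last by move=> ? ?; exact: row_shift_dot.
rewrite raddf_sum /=; under eq_bigr do rewrite mxtraceZ -expr2 sqr_sqrtr// -frob_sqr.
apply: cvx_sum_lt => // j /spsi yj.
rewrite -(OmT j i (open_star_edge yj yi)) -(OmT j k (open_star_edge yj yk)).
rewrite ltr_pXn2r// ?nnegrE ?frob_ge0 ?ltW//.
exact: Omrho (open_star_triangle yj yi yk).
Qed.

(** As psi and iota are arbitrary, this also shows that the union defining [cl] is a single homotopy
    class. *)
Lemma cl_homotopic_av (n : nat) (rho : R) (A : V -> 'M[R]_(n, d)) phi psi iota :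
  partition_of_unity phi -> subordinate phi (open_star R K) ->
  cl_choice (psi, iota) -> approx_cocycle K rho Om ->
  (forall i, Stiefel R d n (A i)) ->
  (forall i j, edge K i j -> frob (A i *m Om i j - A j) < rho) ->
  homotopic R (Gr_oo_nbhd d (Num.sqrt 2 * rho))
    (cl_map psi iota Om) (av phi (fun i => rows_from 0 (A i))).
Proof.
move=> pphi sphi [ppsi spsi iotaI _] Omc A1 AOm; rewrite /= in ppsi spsi iotaI.
have [OmO _ _] := Omc; have [cpsi _ _] := ppsi.
(* p is at least n and exceeds every iota j. Shifting iota by p moves the blocks past all those of
   Xi and, if d > 0, past the n rows of Phi. As iota' j < p + p, all of these fit in m rows. *)
pose p := (n + \sum_j (iota j).+1)%N.
pose iota' j := (iota j + p)%N.
pose m := (n + d * (p + p))%N.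
have iota'I : injective iota' by move=> i j /addIn /iotaI.
have iotap j : (iota j < p)%N.
  by rewrite /p (bigD1 j)//= addnCA leq_addr.
have iota'm j : (d * iota' j + d <= m)%N.
  rewrite addnC -mulnS (leq_trans _ (leq_addl _ _))//.
  by rewrite leq_mul2l /iota' -addSn leq_add2r iotap orbT.
have iotam j : (d * iota j + d <= m)%N.
  by rewrite (leq_trans _ (iota'm j))// leq_add2r leq_mul2l leq_addr orbT.
have nm : (0 + n <= m)%N by rewrite add0n leq_addr.
pose Xi := stacked m psi iota; pose Xi' := stacked m psi iota'.
pose Ph i (y : geom R K) := row_shift R m n 0 *m A i.
have avE : av phi (fun i => rows_from 0 (A i)) =
    fun y => padding (\sum_i phi i y *: (Ph i y *m (Ph i y)^T)).
  apply/funext => y; rewrite /av linear_sum; apply: eq_bigr => i _.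
  by rewrite linearZ /= -gram_rows_from0 -rows_from_shift.
have clE : cl_map psi iota Om =
    fun y => padding (\sum_i psi i y *: (Xi i y *m (Xi i y)^T)).
  by apply/funext => y; exact: cl_map_stacked.
have XiXi' i j y : (Xi i y)^T *m Xi' j y = 0.
  rewrite /Xi /Xi' /stacked (linear_sum (@trmx R m d)) /= mulmx_suml big1// => k _ /=.
  rewrite mulmx_sumr big1// => l _; rewrite trmx_scale -scalemxAl -scalemxAr.
  rewrite trmx_mul -mulmxA (mulmxA (row_shift _ _ _ _)^T) row_shift_disjoint.
    by rewrite mul0mx mulmx0 !scaler0.
  rewrite addnC -mulnS leq_mul2l; apply/orP; right.
  by rewrite (leq_trans (iotap k))// leq_addl.
have Xi'Ph i j y : (Xi' i y)^T *m Ph j y = 0.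
  rewrite -[LHS]trmxK trmx_mul trmxK /Xi' /stacked mulmx_sumr big1 ?trmx0// => k _.
  rewrite -scalemxAr /Ph trmx_mul -mulmxA (mulmxA (row_shift _ _ _ _)^T).
  (* For d = 0 the shift by d p is void, but the product is an empty matrix. *)
  case: (posnP d) => [d0|d0].
    by move: (_ *: _); rewrite d0 => Z; rewrite [Z]flatmx0.
  rewrite row_shift_disjoint ?mul0mx ?mulmx0 ?scaler0// add0n.
  rewrite (leq_trans _ (leq_pmull _ d0))// /iota' /p addnCA leq_addr//.
have Xi1 := stacked_orthonormal ppsi spsi iotaI iotam OmO.
have Xi'1 := stacked_orthonormal ppsi spsi iota'I iota'm OmO.
rewrite avE clE.
(* The first homotopy keeps the weights psi and only moves the rows; the second one takes psi to
   phi. *)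
apply: (@homotopic_trans _ _ _ _ _
  (fun y => padding (\sum_i psi i y *: (Xi' i y *m (Xi' i y)^T)))).
  apply: (@frame_homotopy _ _ _ _ (open_star R K) m _ _ _ Xi Xi' Om) => //.
  - by move=> i; exact: stacked_continuous.
  - by move=> i; exact: stacked_continuous.
  - move=> i k y yi yk; split; first exact: OmO (open_star_edge yi yk).
      exact: stacked_witness.
    exact: stacked_witness.
apply: (@frame_homotopy _ _ _ _ (open_star R K) m _ _ _ Xi' Ph Om) => //.
- by move=> i; exact: stacked_continuous.
- by move=> i; exact: mx_continuous_cst.
- move=> i y _; rewrite /Ph trmx_mul -mulmxA (mulmxA (row_shift _ _ _ _)^T).
  by rewrite row_shift_orthonormal// mul1mx A1.
- move=> i k y yi yk; have eik := open_star_edge yi yk; split; first exact: OmO.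
    exact: stacked_witness.
  by rewrite /Ph -mulmxA -mulmxBr frob_mulmxl ?row_shift_orthonormal//; exact: AOm.
Qed.

End StackedFrames.

(** * Barycentric coordinates, edges of the Čech complex and witnesses *)

Section BarycentricCoordinates.
Variables (R : realType) (V : finType) (K : scomplex V).

Lemma barycentric_continuous (v : V) :
  continuous (fun y : geom R K => set_val y v : R).
Proof.
move=> y.
apply: (@continuous_comp _ _ _ (fun y : geom R K => set_val y)
  (fun c : {ptws V -> R} => c v)).
  exact: initial_continuous.
exact: proj_continuous.
Qed.

Lemma barycentric_partition :
  partition_of_unity (fun v (y : geom R K) => set_val y v : R).
Proof.
split=> [v|v y|y]; first exact: barycentric_continuous.
  by have [h _ _] := set_valP y; exact: h.
by have [_ h _] := set_valP y.
Qed.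

Lemma barycentric_subordinate :
  subordinate (fun v (y : geom R K) => set_val y v : R) (open_star R K).
Proof.
by move=> v y yv; rewrite /open_star /= lt_def yv; have [h _ _] := set_valP y; exact: h.
Qed.

End BarycentricCoordinates.

(** The balls around the two ends of an edge share a point p, at distance less than eps from
    both. *)
Lemma frob_cech_edge (R : realType) (N : nat) (X : {fset 'rV[R]_N}) (eps : R)
    (eps_gt0 : 0 < eps) (x x' : X) : edge (cech X eps_gt0) x x' ->
  frob_dist (val x) (val x') < 2 * eps.
Proof.
move=> [_ [p px]].
have h1 : frob_dist (val x) p < eps by apply: px; rewrite /= !inE eqxx.
have h2 : frob_dist (val x') p < eps by apply: px; rewrite /= !inE eqxx orbT.
rewrite /frob_dist; have -> : val x - val x' = (val x - p) + (p - val x').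
  by rewrite addrA subrK.
apply: le_lt_trans (frob_triangle _ _) _.
by rewrite (frob_distC p) mulr_natl mulr2n ltrD.
Qed.


(** Orient each edge by an enumeration of the vertices, choose W for this orientation and take its
    transpose for the other. The bound carries over because ||A_i W^T - A_j|| = ||A_i - A_j W||; on
    the diagonal the identity has error 0 < r. *)
Lemma symmetric_witness (R : realType) (d : nat) (V : finType) (K : scomplex V)
    (r : R) (n : nat) (A : V -> 'M[R]_(n, d)) : 0 < r ->
  (forall i j, edge K i j -> exists2 W, orthogonal_group R d W &
     frob (A i *m W - A j) < r) ->
  exists Om : V -> V -> 'M[R]_d,
    sym_family K Om /\
    forall i j, edge K i j ->
      orthogonal_group R d (Om i j) /\ frob (A i *m Om i j - A j) < r.
Proof.
move=> r0 AW.
have [W WP] : exists W : V -> V -> 'M[R]_d, forall i j, edge K i j ->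
    orthogonal_group R d (W i j) /\ frob (A i *m W i j - A j) < r.
  have /choice[W WP] : forall ij : V * V, exists W, edge K ij.1 ij.2 ->
      orthogonal_group R d W /\ frob (A ij.1 *m W - A ij.2) < r.
    move=> [i j] /=; have [/AW[W W1 Wr]|ne] := pselect (edge K i j).
      by exists W.
    (* A default value off the edges, where nothing is required. *)
    by exists 0.
  by exists (fun i j => W (i, j)) => i j; exact: (WP (i, j)).
have edgeC i j : edge K i j -> edge K j i by rewrite /edge finset.setUC.
pose Om i j := if i == j then 1%:M else
  if (enum_rank i < enum_rank j)%N then W i j else (W j i)^T.
exists Om; split; first split.
- move=> i j _; rewrite /Om (eq_sym j); case: (eqVneq i j) => [_|ij].
    by rewrite trmx1.
  case: ltngtP => [_|_|/ord_inj/enum_rank_inj ijE]; rewrite ?trmxK//.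
  by rewrite ijE eqxx in ij.
- by move=> i; rewrite /Om eqxx.
- move=> i j eij; rewrite /Om; case: (eqVneq i j) => [->|ij].
    rewrite /orthogonal_group /= trmx1 !mulmx1 subrr; split=> //.
    by rewrite frob0.
  case: ifP => _; first exact: WP.
  have [W1 Wr] := WP _ _ (edgeC _ _ eij); have W1' := mulmx1C W1.
  rewrite /orthogonal_group /= trmxK; split=> //.
  rewrite -(@frob_mulmxr _ _ _ _ (W j i))// mulmxBl -mulmxA W1 mulmx1.
  by rewrite frob_distC.
Qed.

(** Multiplying by the isometry A_i turns the cocycle defect into a sum of three witness errors, on
    (ij), (jk) and (ik), each of norm less than r. *)
Lemma witness_cocycle (R : realType) (d : nat) (V : finType) (K : scomplex V)
    (r : R) (n : nat) (A : V -> 'M[R]_(n, d)) (Om : V -> V -> 'M[R]_d) :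
  (forall i, Stiefel R d n (A i)) -> sym_family K Om ->
  (forall i j, edge K i j ->
     orthogonal_group R d (Om i j) /\ frob (A i *m Om i j - A j) < r) ->
  approx_cocycle K (3 * r) Om.
Proof.
move=> A1 OmS OmP; split=> // [i j /OmP[]//|i j k tijk].
have edg a b : a \in [set i; j; k]%SET -> b \in [set i; j; k]%SET -> edge K a b.
  move=> aS bS; apply: face_sub tijk _ _; last first.
    by apply/set0Pn; exists a; rewrite !inE eqxx.
  by apply/fintype.subsetP => c; rewrite in_set2 => /orP[] /eqP ->.
have [_ hij] : orthogonal_group R d (Om i j) /\ frob (A i *m Om i j - A j) < r.
  by apply: OmP; apply: edg; rewrite !inE eqxx ?orbT.
have [Wjk hjk] : orthogonal_group R d (Om j k) /\ frob (A j *m Om j k - A k) < r.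
  by apply: OmP; apply: edg; rewrite !inE eqxx ?orbT.
have [_ hik] : orthogonal_group R d (Om i k) /\ frob (A i *m Om i k - A k) < r.
  by apply: OmP; apply: edg; rewrite !inE eqxx ?orbT.
rewrite -(frob_mulmxl _ (A1 i)).
have -> : A i *m (Om i j *m Om j k - Om i k) = (A i *m Om i j - A j) *m Om j k +
    (A j *m Om j k - A k) + (A k - A i *m Om i k).
  by rewrite mulmxBl mulmxBr mulmxA subrKA addrA subrK.
rewrite (_ : 3 * r = r + r + r); last by ring.
apply: le_lt_trans (frob_triangle _ _) _; rewrite ltrD//; last by rewrite frob_distC.
apply: le_lt_trans (frob_triangle _ _) _; rewrite ltrD//.
by rewrite frob_mulmxr//; exact: mulmx1C.
Qed.

Theorem lemma5p10 (R : realType) (N n d : nat) (X : {fset 'rV[R]_N})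
    (eps delta ell : R) (eps_gt0 : 0 < eps) (delta_ge0 : 0 <= delta)
    (ell_gt0 : 0 < ell) (f : X -> 'M[R]_n) (fGr : forall x : X, Gr R d n (f x))
    (fLip : approx_lipschitz (fun x x' : X => frob_dist (val x) (val x'))
              (@frob_dist R n n) delta ell f) :
  let K := cech X eps_gt0 in
  let r := 2 * ell * eps + delta in
  let B := Gr_oo_nbhd d (3 * Num.sqrt 2 * r) in
  exists (phi : X -> geom R K -> R) (Phi : X -> fsmx R nat 'I_d),
    [/\ partition_of_unity phi,
        subordinate phi (open_star R K),
        DT K r Phi,
        av phi Phi = @padding R n \o cech_map eps_gt0 f &
        exists Om : X -> X -> 'M[R]_d,
          [/\ witness K r Phi Om,
              sym_family K Om,
              approx_cocycle K (3 * r) Om,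
              is_map B (@padding R n \o cech_map eps_gt0 f) &
              cl K (3 * r) Om =
                hclass R B (@padding R n \o cech_map eps_gt0 f)]].
Proof.
move=> K r B.
have r0 : 0 < r by rewrite ltr_pwDl// mulr_gt0// mulr_gt0.
have /choice[A AP] : forall x : X, exists A, Stiefel R d n A /\ A *m A^T = f x.
  by move=> x; have [A A1 AE] := Gr_frame (fGr x); exists A.
have A1 x : Stiefel R d n (A x) by have [] := AP x.
have AE x : A x *m (A x)^T = f x by have [] := AP x.
(* Points joined by an edge are at distance less than 2 eps; the bound stays strict because ell >
   0. *)
have f_edge (x x' : X) : edge K x x' -> frob (f x - f x') < r.
  move=> /frob_cech_edge xx'; apply: le_lt_trans (fLip x x') _.
  by rewrite ltrD2r -mulrA mulrCA ltr_pM2l.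
have AW (x x' : X) : edge K x x' ->
    exists2 W, orthogonal_group R d W & frob (A x *m W - A x') < r.
  move=> xx'; have [W W1 AWr] := procrustes (A1 x) (A1 x').
  by exists W => //; rewrite (le_lt_trans AWr)// !AE f_edge.
have [Om [OmS OmP]] := symmetric_witness r0 AW.
have Omc : approx_cocycle K (3 * r) Om := witness_cocycle A1 OmS OmP.
pose phi (x : X) (y : geom R K) : R := set_val y x.
pose Phi x := rows_from 0 (A x).
have pphi : partition_of_unity phi := barycentric_partition R K.
have sphi : subordinate phi (open_star R K) := @barycentric_subordinate R _ K.
have avE : av phi Phi = @padding R n \o cech_map eps_gt0 f.
  apply/funext => y; rewrite /av /cech_map /= linear_sum; apply: eq_bigr => x _.
  by rewrite linearZ /= gram_rows_from0 AE.
have OmPhi x x' : edge K x x' -> fs_frob (fs_mulmx (Phi x) (Om x x') - Phi x') < r.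
  by move=> /OmP[_ h]; rewrite fs_mulmx_rows_from -linearB fs_frob_rows_from0.
exists phi, Phi; split => //.
  split=> [x|x x' xx']; first by exists n => //; exists (A x).
  by exists (Om x x'); [have [] := OmP _ _ xx'|exact: OmPhi].
(* On a simplex all f(x) are within r of f(k) for any vertex k of nonzero weight, hence so is their
   average, and r <= 3 sqrt(2) r. *)
have f_map : is_map B (@padding R n \o cech_map eps_gt0 f).
  split=> [y|y].
    apply: continuous_comp; last exact: padding_continuous.
    apply: mx_continuousP; apply: mx_continuous_sum => x.
    apply: mx_continuousZ; first exact: barycentric_continuous.
    exact: mx_continuous_cst.
  have [_ phi0 phi1] := pphi; have [k yk] := cvx_neq0 (phi1 y).
  exists (padding (f k)); first by exists n => //; exists (f k).
  rewrite /= -linearB fs_frob_padding; apply: (frob_cvx_lt (phi0^~ y) (phi1 y)) => x yx.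
  have := f_edge _ _ (open_star_edge (sphi _ _ yx) (sphi _ _ yk)).
  have sqrt2_ge1 : 1 <= Num.sqrt 2 :> R by rewrite -[leLHS]sqrtr1 ler_sqrt// ler1n.
  by move=> /lt_le_trans; apply; rewrite ler_peMl ?(ltW r0)//; lra.
(* Om is a cocycle up to 3r and intertwines the frames A up to r < 3r, so the comparison applies
   with rho = 3r. *)
have clB p : cl_choice p ->
    homotopic R B (cl_map p.1 p.2 Om) (@padding R n \o cech_map eps_gt0 f).
  case: p => psi iota pc; rewrite -avE /B -mulrA [X in Gr_oo_nbhd d X]mulrCA.
  apply: cl_homotopic_av => //= x x' /OmP[_ h].
  by apply: lt_trans h _; rewrite ltr_pMl// ltr1n.
exists Om; split => //.
  by move=> x x' xx'; split; [have [] := OmP _ _ xx'|exact: OmPhi].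
rewrite /cl mulrCA mulrA -/B; apply/seteqP; split=> [g [p pc [gB pg]]|g [gB fg]].
  by split=> //; apply: homotopic_trans pg; apply: homotopic_sym; exact: clB.
(* One admissible choice is enough here; the successor makes iota positive. *)
exists (phi, fun x => (enum_rank x).+1).
  by split=> // x x' /= /succn_inj/ord_inj/enum_rank_inj.
split=> //; apply: homotopic_trans fg; apply: (clB (_, _)).
by split=> // x x' /= /succn_inj/ord_inj/enum_rank_inj.
Qed.
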